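(* (a) Every extremal valued field is algebraically complete. (b) Every finite extension (with any extension of the valuation) of an extremal valued field is again extremal.
   Context: $(K,v)$ with valuation ring $\mathcal{O}_v$ and value group $\Gamma$ (and $v(0)=\infty$) is extremal if for every $n\ge1$ and every $F\in K[X_1,\dots,X_n]$ the set $\{v(F(a_1,\dots,a_n)) : a_i\in\mathcal{O}_v\}\subseteq\Gamma\cup\{\infty\}$ has a maximal element. $(K,v)$ is algebraically complete if it is henselian and every finite extension $(L,w)$, with value group $\Delta$ and residue field $l$, satisfies $[L:K]=(\Delta:\Gamma)[l:k]$, where $k$ is the residue field of $K$. *)

(* Defs.v *)
From HB Require Import structures.
From mathcomp Require Import all_boot all_order all_algebra all_field.
Set Implicit Arguments. Unset Strict Implicit. Unset Printing Implicit Defensive.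
Import GRing.Theory.
Local Open Scope ring_scope.

Record oag := OAG {
  gcar :> zmodType;
  gle : rel gcar;
  gle_refl : reflexive gle;
  gle_trans : transitive gle;
  gle_anti : antisymmetric gle;
  gle_total : total gle;
  gle_add : forall a b c : gcar, gle a b -> gle (a + c) (b + c)
}.

(** Gamma ∪ {∞} is [option G], with [None] = ∞. *)
Definition vle (G : oag) (x y : option G) : bool :=
  match y, x with
  | None, _ => true
  | Some _, None => false
  | Some y', Some x' => gle x' y'
  end.
Definition vlt (G : oag) (x y : option G) : bool := vle x y && (x != y).
Definition vadd (G : oag) (x y : option G) : option G :=
  match x, y with
  | Some a, Some b => Some (a + b)
  | _, _ => None
  end.

Record valuation (K : fieldType) (G : oag) := Valuation {
  vfun :> K -> option G;
  vfun0 : forall x, vfun x = None <-> x = 0;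
  vfunM : forall x y, vfun (x * y) = vadd (vfun x) (vfun y);
  vfunD : forall x y, vle (vfun x) (vfun (x + y)) || vle (vfun y) (vfun (x + y))
}.

Definition in_O (K : fieldType) (G : oag) (v : valuation K G) (x : K) : bool :=
  vle (Some 0) (v x).
Definition in_m (K : fieldType) (G : oag) (v : valuation K G) (x : K) : bool :=
  vlt (Some 0) (v x).

Definition mpoly (K : fieldType) (n : nat) := seq (K * n.-tuple nat).
Definition meval (K : fieldType) (n : nat) (F : mpoly K n) (a : 'I_n -> K) : K :=
  \sum_(m <- F) m.1 * \prod_(i < n) a i ^+ tnth m.2 i.

Definition extremal (K : fieldType) (G : oag) (v : valuation K G) : Prop :=
  forall n : nat, (0 < n)%N -> forall F : mpoly K n,
    exists a : 'I_n -> K, (forall i, in_O v (a i)) /\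
      forall b : 'I_n -> K, (forall i, in_O v (b i)) ->
        vle (v (meval F b)) (v (meval F a)).

Definition henselian (K : fieldType) (G : oag) (v : valuation K G) : Prop :=
  forall (f : {poly K}) (a : K),
    f \is monic -> (forall i, in_O v f`_i) -> in_O v a ->
    in_m v f.[a] -> v (f^`().[a]) = Some 0 ->
    exists b : K, [/\ in_O v b, f.[b] = 0 & in_m v (b - a)].

Definition extends (K : fieldType) (G : oag) (v : valuation K G)
    (L : fieldExtType K) (D : oag) (w : valuation L D) : Prop :=
  exists iota : G -> D,
    [/\ forall g h : G, iota (g + h) = iota g + iota h,
        forall g h : G, gle g h = gle (iota g) (iota h)
      & forall x : K, w (x%:A) = omap iota (v x)].

(** (Delta : Gamma) = e, where Gamma is identified with w(K^x) inside Delta: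
    s_1..s_e in L^x whose values represent each coset exactly once. *)
Definition ram_index (K : fieldType) (L : fieldExtType K) (D : oag)
    (w : valuation L D) (e : nat) : Prop :=
  exists s : seq L,
    [/\ size s = e, all (fun y => y != 0) s,
        forall i j : nat, (i < e)%N -> (j < e)%N -> i <> j ->
          forall x : K, x != 0 -> w s`_i <> vadd (w s`_j) (w x%:A)
      & forall y : L, y != 0 -> exists i : nat, exists x : K,
          [/\ (i < e)%N, x != 0 & w y = vadd (w s`_i) (w x%:A)]].

(** [l : k] = f: s_1..s_f in O_w whose residues form a k-basis of l. *)
Definition res_deg (K : fieldType) (G : oag) (v : valuation K G)
    (L : fieldExtType K) (D : oag) (w : valuation L D) (f : nat) : Prop :=
  exists s : seq L,
    [/\ size s = f, all (in_O w) s,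
        forall c : 'I_f -> K, (forall i, in_O v (c i)) ->
          in_m w (\sum_(i < f) c i *: s`_i) -> forall i, in_m v (c i)
      & forall y : L, in_O w y -> exists c : 'I_f -> K,
          (forall i, in_O v (c i)) /\ in_m w (y - \sum_(i < f) c i *: s`_i)].

Definition alg_complete (K : fieldType) (G : oag) (v : valuation K G) : Prop :=
  henselian v /\
  forall (L : fieldExtType K) (D : oag) (w : valuation L D), extends v w ->
    exists e f : nat,
      [/\ ram_index w e, res_deg v w f & \dim (fullv : {vspace L}) = (e * f)%N].

(* Main.v *)
Require Import Defs.
From HB Require Import structures.
From mathcomp Require Import all_boot all_order all_algebra all_field.
From mathcomp Require Import zify ring.
From Stdlib Require Import Classical_Prop.

(** The only consequence of extremality that is used is that the value of a polynomial
    function on O^N has a maximum, applied to suitable determinants.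

    Hensel: let g in O[X] have g_r = 1 and g_i divisible by some c in m for i > r.  At a
    maximum of the value of Res(h, g), for h monic of degree r in a ball of radius c, the
    resultant vanishes, since h + (g %% h) would improve it.  For r = 1 this gives
    Hensel's lemma; in general it shows that an irreducible monic polynomial with
    integral constant coefficient is integral.  Hence [L:K] w(y) = v(N(y)) for every
    finite extension (L, w), so w of an L-valued polynomial function on O^N has a
    maximum too.

    Defectlessness: let s_i represent the cosets of the value groups and t_j lift a basis
    of the residue extension.  If y were outside the span of the s_i t_j, an element u of
    the span maximising w(y - u) could be improved.

    Extremality of L: for s in L, the set of values v(y) <= w(s), y in K, has a maximum
    (again by maximising a norm), so rescaling the s_i t_j gives an O-basis of O_w, and
    N(F) is then a polynomial function on a power of O. *)

Set Implicit Arguments. Unset Strict Implicit. Unset Printing Implicit Defensive.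
Import GRing.Theory.
Local Open Scope ring_scope.

(* Value groups enter only through the preorder v x <= v y; this avoids the embedding of
   the value group of K into that of L. *)
Definition vdv (K : fieldType) (G : oag) (v : valuation K G) : rel K :=
  fun x y => vle (v x) (v y).

Notation "x <=[ v ] y" := (vdv v x y) (at level 70, v at level 10, no associativity).
Notation "x <![ v ] y" := (~~ vdv v y x) (at level 70, v at level 10, no associativity).

(** A total preorder is the right setting, as distinct field elements may have equal value;
    instantiated with [geq], it yields a largest index. *)
Lemma exists_least (T : Type) (r : rel T) (I : finType) (P : pred I) (F : I -> T) :
  total r -> transitive r -> (exists i, P i) ->
  exists2 i, P i & forall j, P j -> r (F i) (F j).
Proof.
move=> rt rtr [i0 Pi0].
have rr x : r x x by have := rt x x; rewrite orbb.
suff H (s : seq I) : i0 \in s -> exists2 i, P i & {in s, forall j, P j -> r (F i) (F j)}.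
  have [i Pi Hi] := H (enum I) (mem_enum _ _).
  by exists i => // j; apply: Hi; rewrite mem_enum.
move=> _; elim: s => [|k s [i Pi Hi]]; first by exists i0.
case Pk: (P k); last first.
  by exists i => // j; rewrite inE => /predU1P[->|/Hi//]; rewrite Pk.
have /orP[ki|ik] := rt (F k) (F i).
  exists k => // j; rewrite inE => /predU1P[->//|js Pj].
  exact: rtr ki (Hi j js Pj).
by exists i => // j; rewrite inE => /predU1P[->//|/Hi].
Qed.

(** * The preorder of values and the valuation ring *)

Section ValuationTheory.
Variables (K : fieldType) (G : oag) (v : valuation K G).
Implicit Types x y z : K.

Lemma vfun1 : v 1 = Some 0.
Proof.
case E: (v 1) => [g|]; last by move/vfun0: E => /eqP; rewrite oner_eq0.
have := vfunM v 1 1; rewrite mulr1 E => -[/eqP].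
by rewrite -subr_eq0 opprD addrA subrr sub0r oppr_eq0 => /eqP->.
Qed.

Lemma oag_double_eq0 (g : G) : g + g = 0 -> g = 0.
Proof.
move=> gg; have /orP[h|h] := gle_total (0 : G) g; apply: gle_anti; rewrite h ?andbT.
  by have := gle_add g h; rewrite gg add0r => ->.
by have := gle_add g h; rewrite gg add0r => ->.
Qed.

Lemma vfunN1 : v (-1) = Some 0.
Proof.
case E: (v (-1)) => [g|]; last by move/vfun0: E => /eqP; rewrite oppr_eq0 oner_eq0.
have := vfunM v (-1) (-1); rewrite mulrNN mulr1 E vfun1 => -[/esym].
by move/oag_double_eq0->.
Qed.

Lemma vdv_refl : reflexive (vdv v).
Proof. by move=> x; rewrite /vdv /vle; case: (v x) => // g; apply: gle_refl. Qed.

Lemma vdv_trans : transitive (vdv v).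
Proof.
move=> y x z; rewrite /vdv /vle; case: (v x) (v y) (v z) => [a|] [b|] [c|] //.
exact: gle_trans.
Qed.

Lemma vdv_total : total (vdv v).
Proof.
move=> x y; rewrite /vdv /vle; case: (v x) (v y) => [a|] [b|] //.
exact: gle_total.
Qed.

Lemma vdv_strictW x y : x <![v] y -> x <=[v] y.
Proof. by move=> h; have := vdv_total x y; rewrite (negbTE h) orbF. Qed.

Lemma vdv_strict_trans y x z : x <=[v] y -> y <![v] z -> x <![v] z.
Proof. by move=> xy; apply: contra => zx; apply: vdv_trans xy. Qed.

Lemma vdv_strict_transr y x z : x <![v] y -> y <=[v] z -> x <![v] z.
Proof. by move=> xy yz; apply: contra xy; apply: vdv_trans. Qed.

Lemma vdv0 x : x <=[v] 0.
Proof. by have /vfun0 E : (0 : K) = 0 by []; rewrite /vdv E. Qed.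

Lemma vdv0l x : (0 <=[v] x) = (x == 0).
Proof.
have /vfun0 E : (0 : K) = 0 by [].
rewrite /vdv E; apply/idP/eqP => [h|->]; last by rewrite E.
by apply/(vfun0 v); case: (v x) h.
Qed.

Lemma vdvM2r z x y : z != 0 -> (x * z <=[v] y * z) = (x <=[v] y).
Proof.
move=> z0; rewrite /vdv !vfunM; case E: (v z) => [g|]; last first.
  by move/vfun0: E z0 => ->; rewrite eqxx.
case: (v x) (v y) => [a|] [b|] //=; apply/idP/idP; last exact: gle_add.
by move/(gle_add (-g)); rewrite !addrK.
Qed.

Lemma vdvM2l z x y : z != 0 -> (z * x <=[v] z * y) = (x <=[v] y).
Proof. by rewrite ![z * _]mulrC; apply: vdvM2r. Qed.

Lemma vdvMr z x y : x <=[v] y -> x * z <=[v] y * z.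
Proof.
by have [->|z0] := eqVneq z 0; rewrite ?mulr0 ?vdv_refl // vdvM2r.
Qed.

Lemma vdvM x y x' y' : x <=[v] y -> x' <=[v] y' -> x * x' <=[v] y * y'.
Proof.
move=> h h'; apply: vdv_trans (vdvMr x' h) _.
by rewrite ![y * _]mulrC; apply: vdvMr.
Qed.

Lemma vdv_divr z x y : z != 0 -> (x <=[v] y / z) = (x * z <=[v] y).
Proof. by move=> z0; rewrite -(vdvM2r _ _ z0) divfK. Qed.

Lemma vdv_divl z x y : z != 0 -> (x / z <=[v] y) = (x <=[v] y * z).
Proof. by move=> z0; rewrite -(vdvM2r _ _ z0) divfK. Qed.

Lemma vdvD z x y : z <=[v] x -> z <=[v] y -> z <=[v] x + y.
Proof.
rewrite /vdv => zx zy; have /orP[h|h] := vfunD v x y.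
  exact: (vdv_trans (y := x) zx h).
exact: (vdv_trans (y := y) zy h).
Qed.

Lemma vdvNr x y : (x <=[v] - y) = (x <=[v] y).
Proof.
by rewrite /vdv -mulN1r vfunM vfunN1; case: (v y) => //= g; rewrite add0r.
Qed.

Lemma vdvNl x y : (- x <=[v] y) = (x <=[v] y).
Proof.
by rewrite /vdv -mulN1r vfunM vfunN1; case: (v x) => //= g; rewrite add0r.
Qed.

Lemma vdvB z x y : z <=[v] x -> z <=[v] y -> z <=[v] x - y.
Proof. by move=> zx zy; apply: vdvD; rewrite ?vdvNr. Qed.

Lemma vdv_strictD z x y : z <![v] x -> z <![v] y -> z <![v] x + y.
Proof.
move=> zx zy; have /orP[h|h] := vdv_total x y.
  by apply: vdv_strict_transr zx _; apply: vdvD; rewrite ?vdv_refl.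
by apply: vdv_strict_transr zy _; apply: vdvD; rewrite ?vdv_refl.
Qed.

Lemma vdv_strict0 z : (z <![v] 0) = (z != 0).
Proof. by rewrite vdv0l. Qed.

Lemma vdv_sum (I : Type) (r : seq I) (P : pred I) (F : I -> K) z :
  (forall i, P i -> z <=[v] F i) -> z <=[v] \sum_(i <- r | P i) F i.
Proof. by move=> h; apply: (big_ind (fun x => z <=[v] x)) => //; [apply: vdv0|move=> ??; apply: vdvD]. Qed.

Lemma vdv_strict_sum (I : Type) (r : seq I) (P : pred I) (F : I -> K) z : z != 0 ->
  (forall i, P i -> z <![v] F i) -> z <![v] \sum_(i <- r | P i) F i.
Proof.
move=> z0 h; apply: (big_ind (fun x => z <![v] x)) => //; first by rewrite vdv_strict0.
by move=> ??; apply: vdv_strictD.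
Qed.

Lemma vdvX n x y : x <=[v] y -> x ^+ n <=[v] y ^+ n.
Proof.
by move=> h; elim: n => [|n IH]; rewrite ?expr0 ?vdv_refl // !exprS; apply: vdvM.
Qed.

Lemma vdvX2 n x y : (0 < n)%N -> (x ^+ n <=[v] y ^+ n) = (x <=[v] y).
Proof.
move=> n0; apply/idP/idP => [|/vdvX->//].
apply: contraTT => yx; have yx' := vdv_strictW yx.
case: n n0 => // n _; rewrite !exprSr.
have y0 : y != 0 by rewrite -vdv0l; apply: contra yx => h; apply: vdv_trans (vdv0 _) h.
apply: vdv_strict_transr (_ : y ^+ n * x <=[v] x ^+ n * x); last exact: vdvMr (vdvX _ _).
by rewrite vdvM2l ?expf_neq0.
Qed.

Lemma in_OE x : in_O v x = (1 <=[v] x).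
Proof. by rewrite /in_O /vdv vfun1. Qed.

Lemma in_mE x : in_m v x = (1 <![v] x).
Proof.
rewrite /in_m /vlt /vdv vfun1 /vle; case: (v x) => [g|] //.
have [->|n0] := eqVneq g 0; first by rewrite eqxx andbF gle_refl.
have -> : (Some (0 : G) != Some g) by rewrite eq_sym; apply: contraNneq n0 => -[->].
rewrite andbT; apply/idP/idP => h.
  by apply: contra n0 => h'; apply/eqP/gle_anti; rewrite h h'.
by have := gle_total (0 : G) g; rewrite (negbTE h) orbF.
Qed.

Lemma vfun_eqE x y : v x = v y <-> x <=[v] y /\ y <=[v] x.
Proof.
rewrite /vdv /vle; split=> [->|[]].
  by case: (v y) => // g; rewrite gle_refl.
by case: (v x) (v y) => [a|] [b|] // h h'; rewrite (gle_anti (introT andP (conj h h'))).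
Qed.

(** Packaged as a subring predicate, so that the [rpred] and [polyOver] lemmas settle
    integrality. *)
Definition valring : {pred K} := fun x => 1 <=[v] x.

Lemma valring_subring_closed : subring_closed valring.
Proof.
split=> [|x y|x y]; rewrite !unfold_in ?vdv_refl //; first exact: vdvB.
by move=> x1 y1; rewrite -[1]mulr1; apply: vdvM.
Qed.

HB.instance Definition _ := GRing.isSubringClosed.Build K valring valring_subring_closed.

Lemma valringE x : (x \in valring) = (1 <=[v] x). Proof. by []. Qed.

Lemma in_O_valring x : in_O v x = (x \in valring).
Proof. exact: in_OE. Qed.

Lemma vdv_mull x y : x \in valring -> y <=[v] x * y.
Proof. by move=> xO; rewrite -{1}[y]mul1r; apply: vdvMr. Qed.

End ValuationTheory.

(** * Polynomial functions *)

(** The variables lie in K and have any finite index type, while the values may lie in any K-module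
    [A]; this covers functions from powers of K to L. *)
Definition polyfun (K : fieldType) (I : finType) (A : lmodType K) (g : (I -> K) -> A) :=
  exists F : seq (A * {ffun I -> nat}),
    forall a, g a = \sum_(m <- F) (\prod_i a i ^+ m.2 i) *: m.1.

Section PolyFun.
Variables (K : fieldType) (I : finType).
Implicit Types A B : lmodType K.

Lemma eq_polyfun A (g h : (I -> K) -> A) : g =1 h -> polyfun g -> polyfun h.
Proof. by move=> gh [F HF]; exists F => a; rewrite -gh. Qed.

Lemma polyfun_const A (c : A) : polyfun (fun _ : I -> K => c).
Proof.
exists [:: (c, [ffun=> 0%N])] => a; rewrite big_seq1 big1 ?scale1r // => i _.
by rewrite ffunE.
Qed.

Lemma polyfun_var (i : I) : polyfun (A := K^o) (fun a => a i).
Proof.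
exists [:: (1, [ffun j => (j == i) : nat])] => a.
rewrite big_seq1 (bigD1 i) //= ffunE eqxx expr1 big1 => [|j /negbTE ji].
  by rewrite mulr1 /GRing.scale /= mulr1.
by rewrite ffunE ji.
Qed.

Lemma polyfunD A (g h : (I -> K) -> A) :
  polyfun g -> polyfun h -> polyfun (fun a => g a + h a).
Proof. by move=> [F HF] [F' HF']; exists (F ++ F') => a; rewrite big_cat HF HF'. Qed.

Lemma polyfun_sum A (J : Type) (r : seq J) (g : J -> (I -> K) -> A) :
  (forall j, polyfun (g j)) -> polyfun (fun a => \sum_(j <- r) g j a).
Proof.
move=> h; elim: r => [|j r IH].
  by apply: eq_polyfun (polyfun_const 0) => a; rewrite big_nil.
by apply: eq_polyfun (polyfunD (h j) IH) => a; rewrite big_cons.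
Qed.

Lemma polyfun_linear A B (phi : {linear A -> B}) (g : (I -> K) -> A) :
  polyfun g -> polyfun (fun a => phi (g a)).
Proof.
move=> [F HF]; exists [seq (phi m.1, m.2) | m <- F] => a.
by rewrite HF big_map linear_sum; apply: eq_bigr => m _; rewrite linearZ.
Qed.

Lemma polyfun_mon A (e : {ffun I -> nat}) (g : (I -> K) -> A) :
  polyfun g -> polyfun (fun a => (\prod_i a i ^+ e i) *: g a).
Proof.
move=> [F HF]; exists [seq (m.1, [ffun i => (e i + m.2 i)%N]) | m : A * {ffun I -> nat} <- F] => a.
rewrite HF big_map scaler_sumr; apply: eq_bigr => m _; rewrite scalerA -big_split.
by congr (_ *: _); apply: eq_bigr => i _; rewrite ffunE exprD.
Qed.

Lemma polyfunZ A (f : (I -> K) -> K) (g : (I -> K) -> A) :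
  polyfun (A := K^o) f -> polyfun g -> polyfun (fun a => f a *: g a).
Proof.
move=> [F HF] pg.
have h (m : K^o * {ffun I -> nat}) :
    polyfun (fun a => (\prod_i a i ^+ m.2 i) *: ((m.1 : K) *: g a)).
  exact/polyfun_mon/(polyfun_linear ( *:%R (m.1 : K))).
apply: eq_polyfun (polyfun_sum F h) => a; rewrite HF scaler_suml.
by apply: eq_bigr => m _; rewrite scalerA.
Qed.

Lemma polyfunM (A : algType K) (f g : (I -> K) -> A) :
  polyfun f -> polyfun g -> polyfun (fun a => f a * g a).
Proof.
move=> [F HF] pg.
have h (m : A * {ffun I -> nat}) :
    polyfun (fun a => (\prod_i a i ^+ m.2 i) *: (m.1 * g a)).
  exact/polyfun_mon/(polyfun_linear (m.1 \*o idfun)).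
apply: eq_polyfun (polyfun_sum F h) => a; rewrite HF mulr_suml.
by apply: eq_bigr => m _; rewrite scalerAl.
Qed.

Lemma polyfunX (A : algType K) (f : (I -> K) -> A) n :
  polyfun f -> polyfun (fun a => f a ^+ n).
Proof.
move=> pf; elim: n => [|n IH]; first exact: polyfun_const.
by apply: eq_polyfun (polyfunM pf IH) => a; rewrite exprS.
Qed.

Lemma polyfun_prod (A : algType K) (J : Type) (r : seq J) (g : J -> (I -> K) -> A) :
  (forall j, polyfun (g j)) -> polyfun (fun a => \prod_(j <- r) g j a).
Proof.
move=> h; elim: r => [|j r IH].
  by apply: eq_polyfun (polyfun_const 1) => a; rewrite big_nil.
by apply: eq_polyfun (polyfunM (h j) IH) => a; rewrite big_cons.
Qed.

Lemma polyfun_det n (M : (I -> K) -> 'M[K]_n) :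
  (forall i j, polyfun (A := K^o) (fun a => M a i j)) ->
  polyfun (A := K^o) (fun a => \det (M a)).
Proof.
move=> h; apply: (polyfun_sum (A := K^o)) => s.
apply: (polyfunM (A := K^o)); first exact: (polyfun_const (_ : K^o)).
by apply: (polyfun_prod (A := K^o)) => i; apply: h.
Qed.

(** The hypothesis [extremal] is opened only here; the variables are renumbered by [enum_val] and
    [enum_rank]. *)
Lemma extremal_polyfun (G : oag) (v : valuation K G) (f : (I -> K) -> K) :
  extremal v -> (0 < #|I|)%N -> polyfun (A := K^o) f ->
  exists2 a : I -> K, (forall i, a i \in valring v) &
    forall b : I -> K, (forall i, b i \in valring v) -> f b <=[v] f a.
Proof.
move=> ext I0 [F HF].
pose F' : mpoly K #|I| := [seq (m.1 : K, [tuple m.2 (enum_val i) | i < #|I|]) | m : K^o * {ffun I -> nat} <- F].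
have mE a : meval F' (a \o enum_val) = f a.
  rewrite /meval HF big_map; apply: eq_bigr => m _ /=.
  rewrite mulrC; congr (_ * _); rewrite [RHS](reindex _ (onW_bij _ (@enum_val_bij I))).
  by apply: eq_bigr => i _; rewrite tnth_mktuple.
have [a [aO aP]] := ext _ I0 F'.
have aK (b : 'I_#|I| -> K) : (b \o enum_rank) \o enum_val =1 b.
  by move=> i /=; rewrite enum_valK.
exists (a \o enum_rank) => [i|b bO]; first by rewrite -in_O_valring; apply: aO.
have meq (b1 b2 : 'I_#|I| -> K) : b1 =1 b2 -> meval F' b1 = meval F' b2.
  by move=> bb; apply: eq_bigr => m _; congr (_ * _); apply: eq_bigr => i _; rewrite bb.
rewrite -!mE (meq _ _ (aK a)); apply: aP => i.
by rewrite in_O_valring; apply: bO.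
Qed.

End PolyFun.
Arguments polyfun_const {K I A} c.
Arguments polyfun_var {K I} i.

(** * Resultants and factorization *)

Section ModularMatrix.
Variable K : fieldType.
Implicit Types g h p q : {poly K}.

(** For [h] of degree [r] this is multiplication by [p] on K[X]/(h) in the basis of powers of X,
    acting on rows; for monic [h] its determinant is the resultant of [h] and [p]. *)
Definition modmx r h p : 'M[K]_r := \matrix_(i, j) (('X^i * p) %% h)`_j.

Lemma poly_sum_coef r p : (size p <= r)%N -> p = \sum_(k < r) p`_k *: 'X^k.
Proof.
move=> sp; rewrite -poly_def; apply/polyP => i; rewrite coef_poly.
by case: ltnP => // ri; rewrite nth_default // (leq_trans sp).
Qed.

Lemma modp_sum h (I : Type) (s : seq I) (F : I -> {poly K}) :
  (\sum_(i <- s) F i) %% h = \sum_(i <- s) (F i %% h).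
Proof. by apply: (big_morph (fun p => p %% h)); [move=> ??; rewrite modpD|rewrite mod0p]. Qed.

Lemma coef_mul_modp r h p q j : (size p <= r)%N ->
  ((p * q) %% h)`_j = \sum_(k < r) p`_k * (('X^k * q) %% h)`_j.
Proof.
move=> /poly_sum_coef {1}->; rewrite mulr_suml modp_sum coef_sum.
by apply: eq_bigr => k _; rewrite -scalerAl modpZl coefZ.
Qed.

Lemma modmxM r h p q : size h = r.+1 -> modmx r h (p * q) = modmx r h p *m modmx r h q.
Proof.
move=> sh; have h0 : h != 0 by rewrite -size_poly_eq0 sh.
apply/matrixP => i j; rewrite !mxE mulrA [_ * q]mulrC -modp_mul mulrC.
rewrite (@coef_mul_modp r); last by rewrite -ltnS -sh ltn_modpN0.
by apply: eq_bigr => k _; rewrite !mxE.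
Qed.

Lemma modmx_modp r h p q : h %| p - q -> modmx r h p = modmx r h q.
Proof.
move=> /eqP pq; apply/matrixP => i j; rewrite !mxE -[in LHS]modp_mul.
suff -> : p %% h = q %% h by rewrite modp_mul.
by apply/eqP; rewrite -subr_eq0 -modpN -modpD pq.
Qed.

Lemma modmx1 r h : size h = r.+1 -> modmx r h 1 = 1%:M.
Proof.
move=> sh; apply/matrixP => i j; rewrite !mxE mulr1 modp_small ?size_polyXn ?sh ?ltnS //.
by rewrite coefXn eq_sym.
Qed.

Lemma modmxZ r h c p : modmx r h (c *: p) = c *: modmx r h p.
Proof. by apply/matrixP => i j; rewrite !mxE -scalerAr modpZl coefZ. Qed.

(** Otherwise Bezout gives an inverse of [p] modulo [h], and the determinant is multiplicative. *)
Lemma det_modmx0_ncoprime r h p : size h = r.+1 ->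
  \det (modmx r h p) = 0 -> ~~ coprimep h p.
Proof.
move=> sh d0; apply/negP => /Bezout_eq1_coprimepP [[u w] /= uw].
have : \det (modmx r h (w * p)) = 1.
  rewrite -(det1 _ r) -(modmx1 sh); congr (\det _); apply: modmx_modp.
  by rewrite -uw opprD addrCA subrr addr0 dvdpNr dvdp_mull.
by rewrite modmxM // det_mulmx d0 mulr0 => /eqP; rewrite eq_sym oner_eq0.
Qed.

(* If 'X^i * p = u_i * h + p_i is the division with remainder, then
   ('X^i + u_i) * p = u_i * (h + p) + p_i, where 'X^i + u_i is monic of degree i. *)
Lemma det_modmx_shift r h p : size h = r.+1 -> (size p <= r)%N ->
  \det (modmx r (h + p) p) = \det (modmx r h p).
Proof.
move=> sh sp; have h0 : h != 0 by rewrite -size_poly_eq0 sh.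
have sh' : size (h + p) = r.+1 by rewrite size_polyDl sh.
have h'0 : h + p != 0 by rewrite -size_poly_eq0 sh'.
pose u (i : 'I_r) := ('X^i * p) %/ h.
have su i : (size (u i) <= i)%N.
  rewrite size_divp // sh /= leq_subLR; apply: leq_trans (size_polyMleq _ _) _.
  by rewrite size_polyXn addSn /= addnC leq_add2r.
pose T : 'M[K]_r := \matrix_(i, k) ('X^i + u i)`_k.
have -> : modmx r h p = T *m modmx r (h + p) p.
  apply/matrixP => i j; rewrite !mxE.
  under eq_bigr => k _ do rewrite !mxE.
  rewrite -coef_mul_modp; last first.
    apply: leq_trans (size_polyD _ _) _; rewrite geq_max size_polyXn ltn_ord /=.
    exact: leq_trans (su i) (ltnW (ltn_ord i)).
  congr ((polyseq _)`_ _); apply: (modpP (q := u i)); last first.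
    by rewrite sh' -sh ltn_modpN0.
  by rewrite mulrDl [in LHS](divp_eq ('X^i * p) h) -/(u i) mulrDr addrAC.
rewrite det_mulmx det_trig => [|]; last first.
  apply/is_trig_mxP => i k ik; rewrite mxE coefD coefXn.
  by rewrite gtn_eqF // add0r nth_default // (leq_trans (su i)) // ltnW.
rewrite big1 ?mul1r // => i _; rewrite mxE coefD coefXn eqxx.
by rewrite nth_default ?addr0.
Qed.

End ModularMatrix.

(** Schoolbook division: as [h] is monic, each step subtracts a multiple of [h] with coefficients in
    [S]. *)
Lemma divp_polyOver (K : fieldType) (S : subringClosed K) (p h : {poly K}) :
  h \is monic -> h \is a polyOver S -> p \is a polyOver S ->
  p %/ h \is a polyOver S /\ p %% h \is a polyOver S.
Proof.
move=> mh hS; have h0 := monic_neq0 mh.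
move: {2}(size p) (leqnn (size p)) => n; elim: n p => [|n IH] p sp pS.
  by move: sp; rewrite leqn0 size_poly_eq0 => /eqP->; rewrite div0p mod0p rpred0.
case: (ltnP (size p) (size h)) => hp.
  by rewrite divp_small ?modp_small ?rpred0.
pose m := lead_coef p *: 'X^(size p - size h).
have mS : m \is a polyOver S.
  by rewrite polyOverZ ?rpredX ?polyOverX // lead_coefE (polyOverP pS).
have sp0 : (0 < size p)%N by apply: leq_trans hp; rewrite size_poly_gt0.
have p0 : p != 0 by rewrite -size_poly_gt0.
have [|qS rS] := IH (p - m * h) _ (rpredB pS (rpredM mS hS)).
  suff : (size (p - m * h)%R <= (size p).-1)%N by lia.
  have sh0 : (0 < size h)%N by rewrite size_poly_gt0.
  apply/leq_sizeP => j jp; rewrite coefB -scalerAl coefZ coefXnM ltnNge.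
  have -> /= : (size p - size h <= j)%N by lia.
  have [->|jne] := eqVneq j (size p).-1.
    have -> : ((size p).-1 - (size p - size h) = (size h).-1)%N by lia.
    by rewrite -!lead_coefE (monicP mh) mulr1 subrr.
  have pj : (size p <= j)%N by lia.
  have hj : (size h <= j - (size p - size h))%N by lia.
  by rewrite (nth_default _ pj) (nth_default _ hj) mulr0 subrr.
have E : p = ((p - m * h) %/ h + m) * h + (p - m * h) %% h.
  by rewrite mulrDl addrAC -divp_eq subrK.
have sr : (size ((p - m * h) %% h)%R < size h)%N by rewrite ltn_modpN0.
by rewrite -(divpP E sr) -(modpP E sr) rpredD.
Qed.

(** * The resultant on a ball of monic polynomials *)

Section Factor.
Variables (K : fieldType) (G : oag) (v : valuation K G).
Local Notation O := (valring v).

Lemma det_valring n (A : 'M[K]_n) : (forall i j, A i j \in O) -> \det A \in O.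
Proof.
move=> AO; apply: rpred_sum => s _; apply: rpredM; last by apply: rpred_prod.
by rewrite rpredX ?rpredN ?rpred1.
Qed.

Lemma modmx_valring r (h p : {poly K}) : h \is monic ->
  h \is a polyOver O -> p \is a polyOver O -> forall i j, modmx r h p i j \in O.
Proof.
move=> mh hO pO i j; rewrite mxE; apply/polyOverP.
by have [] := divp_polyOver mh hO (rpredM (rpredX i (polyOverX O)) pO).
Qed.

Variables (r : nat) (g : {poly K}) (c : K).

(** For [x] in O, these are the monic polynomials of degree [r] whose lower coefficients are
    congruent to those of [g] modulo [c]; the entries of [x] are the variables for extremality. *)
Definition nearpoly (x : 'I_r -> K) : {poly K} :=
  'X^r + \sum_(i < r) (g`_i + c * x i) *: 'X^i.

Lemma size_nearpoly_tail (x : 'I_r -> K) : (size (\sum_(i < r) x i *: 'X^i)%R <= r)%N.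
Proof.
apply: (leq_trans (size_sum _ _ _)); apply/bigmax_leqP => i _.
by apply: leq_trans (size_scale_leq _ _) _; rewrite size_polyXn.
Qed.

Lemma size_nearpoly x : size (nearpoly x) = r.+1.
Proof. by rewrite size_polyDl size_polyXn // ltnS size_nearpoly_tail. Qed.

Lemma nearpoly_monic x : nearpoly x \is monic.
Proof.
by rewrite monicE lead_coefDl ?lead_coefXn // size_polyXn ltnS size_nearpoly_tail.
Qed.

Lemma coef_nearpoly x (i : 'I_r) : (nearpoly x)`_i = g`_i + c * x i.
Proof.
rewrite coefD coefXn ltn_eqF // add0r coef_sum (bigD1 i) //= big1 => [|j ji].
  by rewrite coefZ coefXn eqxx mulr1 addr0.
by rewrite coefZ coefXn eq_sym (negbTE ji : (j == i :> nat) = false) mulr0.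
Qed.

(** Division by a monic polynomial introduces no denominators, so induction on [n] keeps the
    remainder polynomial in [x]. *)
Lemma polyfun_modXn_nearpoly n j :
  polyfun (A := K^o) (fun x => ('X^n %% nearpoly x)`_j).
Proof.
have small x m : (m < r)%N -> 'X^m %% nearpoly x = 'X^m.
  by move=> mr; rewrite modp_small // size_polyXn size_nearpoly.
have tail x p : (size (p %% nearpoly x)%R <= r)%N.
  by rewrite -ltnS -(size_nearpoly x) ltn_modpN0 // monic_neq0 ?nearpoly_monic.
have [rj|jr] := leqP r j.
  apply: eq_polyfun (polyfun_const (0 : K^o)) => x.
  by rewrite nth_default // (leq_trans (tail x _)).
have r0 : (0 < r)%N by apply: leq_ltn_trans jr.
elim: n j jr => [|n IH] j jr.
  by apply: eq_polyfun (polyfun_const (('X^0 : {poly K})`_j : K^o)) => x; rewrite small.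
(* Multiply the previous remainder by X and cancel its coefficient in degree [r]. *)
have E x : 'X^(n.+1) %% nearpoly x
    = 'X * ('X^n %% nearpoly x) - ('X^n %% nearpoly x)`_r.-1 *: nearpoly x.
  set p := 'X^n %% nearpoly x; symmetry.
  apply: (modpP (q := ('X^n %/ nearpoly x) * 'X + (p`_r.-1)%:P)).
    rewrite mulrDl mul_polyC -addrA [X in _ + X]addrCA subrr addr0 exprS.
    by rewrite {1}(divp_eq 'X^n (nearpoly x)) mulrDr mulrAC [_ * 'X]mulrC mulrA.
  rewrite size_nearpoly ltnS; apply/leq_sizeP => i ri.
  rewrite coefB coefXM coefZ eqn0Ngt (leq_trans r0 ri) /=.
  have [->|ir] := eqVneq i r.
    have := monicP (nearpoly_monic x).
    by rewrite lead_coefE size_nearpoly => ->; rewrite mulr1 subrr.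
  have ri' : (r < i)%N by rewrite ltn_neqAle eq_sym ir.
  rewrite [p`_i.-1]nth_default ?[(nearpoly x)`_i]nth_default ?size_nearpoly ?mulr0 ?subrr //.
  by apply: leq_trans (tail x _) _; rewrite -ltnS prednK // (leq_trans r0).
apply: eq_polyfun (_ : polyfun (A := K^o) (fun x =>
    (if j == 0%N then 0 else ('X^n %% nearpoly x)`_j.-1)
      - ('X^n %% nearpoly x)`_r.-1 * (g`_j + c * x (Ordinal jr)))) => [x|].
  by rewrite E coefB coefXM coefZ -(coef_nearpoly x (Ordinal jr)).
rewrite -[X in polyfun X]/(fun x => _ - _).
have pr := IH r.-1 _; rewrite ltn_predL in pr.
have pvar : polyfun (A := K^o) (fun x : 'I_r -> K => g`_j + c * x (Ordinal jr)).
  apply: (polyfunD (A := K^o)); first exact: polyfun_const.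
  exact: (polyfunM (A := K^o) (polyfun_const (c : K^o)) (polyfun_var _)).
apply: (polyfunD (A := K^o)).
  case: eqP => _; first exact: polyfun_const.
  by apply/IH/(leq_ltn_trans (leq_pred j)).
have := polyfunM (A := K^o) (polyfun_const (-1 : K^o)) (polyfunM (A := K^o) (pr r0) pvar).
by apply: eq_polyfun => x; rewrite mulN1r.
Qed.

Lemma polyfun_det_nearpoly (p : {poly K}) :
  polyfun (A := K^o) (fun x => \det (modmx r (nearpoly x) p)).
Proof.
apply: polyfun_det => i j.
apply: eq_polyfun (_ : polyfun (A := K^o) (fun x =>
    \sum_(k < size p) p`_k * ('X^(k + i) %% nearpoly x)`_j)) => [x|].
  rewrite mxE mulrC (coef_mul_modp _ _ _ (leqnn (size p))).
  by apply: eq_bigr => k _; rewrite exprD.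
apply: (polyfun_sum (A := K^o)) => k.
apply: (polyfunM (A := K^o)); first exact: (polyfun_const (p`_k : K^o)).
exact: polyfun_modXn_nearpoly.
Qed.

End Factor.

(* The determinant of multiplication by [g] on K[X]/(h) is a resultant of [h] and [g];
   at a maximum of its value it vanishes, because replacing [h] by [h + (g %% h)]
   multiplies it by a determinant divisible by [c ^+ r]. *)
Lemma extremal_factor (K : fieldType) (G : oag) (v : valuation K G) (r : nat)
    (g : {poly K}) (c : K) :
  extremal v -> (0 < r)%N -> g \is a polyOver (valring v) -> g`_r = 1 ->
  c != 0 -> 1 <![v] c -> (forall i, (r < i)%N -> c <=[v] g`_i) ->
  exists2 x : 'I_r -> K, (forall i, x i \in valring v) & ~~ coprimep (nearpoly g c x) g.
Proof.
move=> ext r0 gO gr c0 c1 gc.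
have cO : c \in valring v by apply: vdv_strictW.
have [|x xO xP] := extremal_polyfun ext _ (@polyfun_det_nearpoly _ r g c g).
  by rewrite card_ord.
exists x => //; apply: (det_modmx0_ncoprime (size_nearpoly g c x)).
apply/eqP; apply/negPn/negP => d0.
set h := nearpoly g c x in d0 *; pose k := c^-1 *: (g - h).
have mh : h \is monic by apply: nearpoly_monic.
have sh : size h = r.+1 by apply: size_nearpoly.
have nearO (y : 'I_r -> K) : (forall i, y i \in valring v) -> nearpoly g c y \is a polyOver (valring v).
  move=> yO; rewrite rpredD ?polyOverXn //; apply: rpred_sum => i _.
  by rewrite polyOverZ ?polyOverXn // rpredD ?rpredM // (polyOverP gO).
(* Below degree [r] this is the shape of [h]; in degree [r] both coefficients are 1; above it, [c]
   divides those of [g]. *)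
have kO : k \is a polyOver (valring v).
  apply/polyOverP => i; rewrite coefZ coefB mulrC valringE vdv_divr // mul1r.
  have [ir|ri|->] := ltngtP i r.
  - by rewrite (coef_nearpoly g c x (Ordinal ir)) /= opprD addNKr vdvNr mulrC vdv_mull.
  - by rewrite [h`_i]nth_default ?subr0 ?gc // sh.
  - by have := monicP mh; rewrite lead_coefE sh gr => ->; rewrite subrr vdv0.
have [qO rO] := divp_polyOver mh (nearO x xO) kO.
(* As g = h + c k, the polynomial c rho is g %% h, so [x'] parametrises h + (g %% h). *)
pose rho := k %% h; pose x' i := x i + rho`_i.
have x'O i : x' i \in valring v by rewrite rpredD // (polyOverP rO).
have sr : (size rho <= r)%N by rewrite -ltnS -sh ltn_modpN0 // monic_neq0.
have hE : nearpoly g c x' = h + c *: rho.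
  rewrite /h /nearpoly -addrA; congr (_ + _).
  rewrite [in RHS](poly_sum_coef sr) scaler_sumr -big_split; apply: eq_bigr => i _ /=.
  by rewrite scalerA -scalerDl mulrDr addrA.
have gE : g = h + c *: k by rewrite scalerA divff // scale1r addrCA subrr addr0.
have := xP x' x'O; apply/negP; rewrite hE -/h.
have dE : \det (modmx r h g) = \det (modmx r (h + c *: rho) (c *: rho)).
  rewrite det_modmx_shift //; last exact: leq_trans (size_scale_leq _ _) sr.
  congr (\det _); apply: modmx_modp; rewrite gE {1}(divp_eq k h) -/rho scalerDr addrA addrK.
  by rewrite dvdp_add ?dvdpZr ?dvdp_mull.
rewrite dE in d0 *.
(* Put q = k %/ h. Then g = (1 + c q) h + c rho, and modulo h + c rho one may replace h by -c rho,
   which leaves -c q (c rho). *)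
have -> : modmx r (h + c *: rho) g
    = modmx r (h + c *: rho) ((- c) *: (k %/ h) * (c *: rho)).
  apply: modmx_modp; rewrite scaleNr mulNr opprK.
  apply/dvdpP; exists (1 + c *: (k %/ h)).
  rewrite {1}gE {1}(divp_eq k h) -/rho -!mul_polyC.
  ring.
rewrite modmxM; last by rewrite -hE size_nearpoly.
rewrite det_mulmx modmxZ detZ.
set d := \det (modmx r _ (c *: _)) in d0 *; set e := \det _.
have eO : e \in valring v.
  by apply: det_valring => i j; apply: modmx_valring; rewrite -?hE ?nearpoly_monic ?nearO.
rewrite -{2}[d]mul1r vdvM2r //.
(* The new determinant is [d] times (-c)^r e with [e] integral, and this factor has positive value
   because r > 0. *)
apply: vdv_strict_transr (_ : c ^+ r <=[v] _).
  by rewrite -(expr1n _ r) vdvX2.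
by rewrite exprNn mulrAC vdv_mull // rpredM // rpredX ?rpredN ?rpred1.
Qed.

(** * Hensel's lemma *)

(** Let p(X) = f(X + a), so that p_0 = c is in m and p_1 = u is a unit. Then g(X) = p(cX) / (cu) has
    g_1 = 1 and higher coefficients divisible by c. A linear polynomial not coprime to g gives a
    root y of g, and cy + a is a root of f. *)
Lemma extremal_henselian (K : fieldType) (G : oag) (v : valuation K G) :
  extremal v -> henselian v.
Proof.
move=> ext f a _ fO; rewrite in_O_valring => aO; rewrite in_mE => fam f'a1.
have {}fO : f \is a polyOver (valring v).
  by apply/polyOverP => i; rewrite -in_O_valring.
set c := f.[a] in fam; set u := f^`().[a] in f'a1.
have [c0|c0] := eqVneq c 0.
  by exists a; rewrite in_O_valring subrr in_mE vdv_strict0 oner_neq0.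
have u0 : u != 0 by apply/eqP => /(vfun0 v); rewrite f'a1.
have /vfun_eqE [u1 u1'] : v u = v 1 by rewrite f'a1 vfun1.
have uVO : u^-1 \in valring v by rewrite valringE -[u^-1]mul1r vdv_divr ?mul1r.
have cO : c \in valring v by apply: vdv_strictW.
pose p := f \Po ('X + a%:P).
have pO : p \is a polyOver (valring v) by rewrite polyOver_comp // polyOverXaddC.
have pE z : p.[z] = f.[z + a] by rewrite horner_comp !hornerE.
have p0 : p`_0 = c by rewrite -horner_coef0 pE add0r.
have p1 : p`_1 = u.
  rewrite -[p`_1]mulr1n -coef_deriv -horner_coef0 deriv_comp derivD derivX derivC.
  by rewrite addr0 mulr1 horner_comp !hornerE.
have p_i i : p`_i \in valring v by apply: (polyOverP pO).
pose g := \poly_(i < size p) (p`_i * c ^+ i / (c * u)).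
have gE i : g`_i = p`_i * c ^+ i / (c * u).
  by rewrite coef_poly; case: ltnP => // h; rewrite nth_default // !mul0r.
have gS i : g`_i.+1 = p`_i.+1 * c ^+ i / u.
  by rewrite gE exprS; field; rewrite c0 u0.
have g0 : g`_0 = u^-1 by rewrite gE p0; field; rewrite c0 u0.
have gO : g \is a polyOver (valring v).
  by apply/polyOverP => -[|i]; rewrite ?g0 // gS !rpredM // rpredX.
have [|i|x xO] := @extremal_factor _ _ v 1 g c ext isT gO _ c0 fam.
- by rewrite gS p1 expr0 mulr1 divff.
- case: i => [|[|i]] // _; rewrite gS exprSr [_ * (_ * _)]mulrA mulrAC.
  by rewrite vdv_mull // !rpredM // rpredX.
pose y := - (g`_0 + c * x ord0).
have -> : nearpoly g c x = 'X - y%:P.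
  by rewrite /nearpoly big_ord1 /= expr1 expr0 -mul_polyC mulr1 /y polyCN opprK.
rewrite coprimep_sym coprimep_XsubC negbK => /rootP gy0.
have yO : y \in valring v by rewrite rpredN rpredD ?rpredM // g0.
exists (c * y + a); split.
- by rewrite in_O_valring rpredD ?rpredM.
- rewrite -pE; transitivity (c * u * g.[y]); last by rewrite gy0 mulr0.
  rewrite horner_coef horner_poly mulr_sumr; apply: eq_bigr => i _.
  by rewrite exprMn; field; rewrite c0 u0.
- by rewrite addrK in_mE; apply: vdv_strict_transr fam _; rewrite mulrC vdv_mull.
Qed.

(** Otherwise let [r] be the last index at which the coefficients attain their least value. It lies
    strictly between 0 and the degree, as the outer coefficients are integral, so [extremal_factor]
    for f / f_r yields a polynomial of degree [r] sharing a factor with [f]. *)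
Lemma extremal_irreducible_integral (K : fieldType) (G : oag) (v : valuation K G)
    (f : {poly K}) :
  extremal v -> f \is monic -> irreducible_poly f -> f`_0 \in valring v ->
  f \is a polyOver (valring v).
Proof.
move=> ext mf [f1 firr] f0; apply/negPn/negP => fO.
have [n sf] : exists n, size f = n.+2.
  by case: (size f) f1 => [|[|n]] // _; exists n.
have fn : f`_n.+1 = 1 by have /monicP := mf; rewrite lead_coefE sf.
pose I := 'I_n.+2.
have [j _ jmin] := @exists_least K (vdv v) I xpredT (fun i => f`_i)
  (vdv_total v) (@vdv_trans _ _ v) (ex_intro _ ord0 isT).
have [r rmin rmax] := @exists_least nat geq I (fun i => f`_i <=[v] f`_j) (@nat_of_ord _)
  (fun x y => leq_total y x) (fun x y z h h' => leq_trans h' h)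
  (ex_intro _ j (vdv_refl v _)).
have rle i : f`_r <=[v] f`_i.
  have [ni|ni] := ltnP i n.+2; last by rewrite (nth_default _ (_ : size f <= i)%N) ?vdv0 ?sf.
  exact: vdv_trans rmin (jmin (Ordinal ni) isT).
have frO : f`_r \notin valring v.
  apply: contra fO => frO; apply/polyOverP => i; exact: vdv_trans frO (rle i).
have fr0 : f`_r != 0 by apply: contraNneq frO => ->; rewrite rpred0.
have r0 : (0 < r)%N by rewrite lt0n; apply: contraNneq frO => ->.
have rn : (r < n.+1)%N.
  rewrite ltn_neqAle -ltnS ltn_ord andbT.
  by apply: contraNneq frO => ->; rewrite fn rpred1.
pose g := (f`_r)^-1 *: f.
have gE i : g`_i = f`_i / f`_r by rewrite coefZ mulrC.
have gO : g \is a polyOver (valring v).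
  by apply/polyOverP => i; rewrite gE valringE vdv_divr // mul1r.
(* The coefficient of least value above [r] serves as [c]: its value is positive by the choice of
   [r], and it is nonzero because [f] is monic. *)
have [k rk kmin] := @exists_least K (vdv v) I (fun i => r < i)%N (fun i => g`_i)
  (vdv_total v) (@vdv_trans _ _ v) (ex_intro _ ord_max rn).
have gk0 : g`_k != 0.
  apply/eqP => gk0; have := kmin ord_max rn.
  by rewrite gk0 vdv0l gE /= fn mul1r invr_eq0 (negbTE fr0).
have gk1 : 1 <![v] g`_k.
  rewrite gE vdv_divl // mul1r; apply/negP => h.
  have /rmax : f`_k <=[v] f`_j by apply: vdv_trans h rmin.
  by rewrite /geq /= leqNgt rk.
have [|i|x _] := @extremal_factor _ _ v r g g`_k ext r0 gO _ gk0 gk1.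
- by rewrite gE divff.
- move=> ri; have [ni|ni] := ltnP i n.+2; first exact: (kmin (Ordinal ni)).
  by rewrite (gE i) (nth_default _ (_ : size f <= i)%N) ?mul0r ?vdv0 ?sf.
rewrite coprimepZr ?invr_eq0 //; apply/negP/negPn.
have := firr _ _ (dvdp_gcdr (nearpoly g g`_k x) f).
rewrite /coprimep; case: eqP => //= _ /(_ isT) /eqp_dvdl h.
have : f %| nearpoly g g`_k x by rewrite -h dvdp_gcdl.
move/dvdp_leq; rewrite -size_poly_eq0 size_nearpoly sf => /(_ isT).
by rewrite ltnNge rn.
Qed.

(** * The norm of a finite extension *)

(** Used to recognise a characteristic polynomial as a power of a minimal polynomial. *)
Lemma monic_dvd_irreducible_exp (K : fieldType) (f p : {poly K}) n :
  f \is monic -> irreducible_poly f -> p \is monic -> p %| f ^+ n ->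
  exists k, p = f ^+ k.
Proof.
move=> mf [f1 firr].
have monic_dvd1 q : q \is monic -> q %| 1 -> q = f ^+ 0.
  rewrite dvdp1 size_poly_eq1 expr0 => mq q1.
  by apply/eqP; rewrite -eqp_monic ?monic1.
elim: n p => [|n IH] p mp pf; first by exists 0%N; apply: monic_dvd1.
have [cop|ncop] := boolP (coprimep p f).
  exists 0%N; apply: monic_dvd1 => //.
  by move: pf; rewrite -[f ^+ _]mulr1 Gauss_dvdpr // coprimep_expr.
have fp : f %| p.
  have := firr _ ncop (dvdp_gcdr p f); by move/eqp_dvdl <-; apply: dvdp_gcdl.
have /dvdpP [q pE] := fp.
have f0 : f != 0 by apply: monic_neq0.
have mq : q \is monic by rewrite -(monicMr q mf) -pE.
have [|k qE] := IH q mq.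
  by rewrite -(dvdp_mul2r _ _ f0) -exprSr -pE.
by exists k.+1; rewrite exprSr -qE.
Qed.

Section Norm.
Variables (K : fieldType) (L : fieldExtType K).
Implicit Types y z : L.

Local Notation n := (\dim {:L}).
Local Notation b := (vbasis {:L}).

Definition mulmat y : 'M[K]_n := \matrix_(i, j) coord b j (b`_i * y).

Lemma mulmatM y z : mulmat (y * z) = mulmat y *m mulmat z.
Proof.
apply/matrixP => i j; rewrite !mxE mulrA [in LHS](coord_vbasis (memvf (b`_i * y))).
rewrite mulr_suml linear_sum; apply: eq_bigr => k _.
by rewrite !mxE -scalerAl linearZ.
Qed.

Lemma mulmat_linear_is_linear : linear mulmat.
Proof. by move=> c y z; apply/matrixP => i j; rewrite !mxE mulrDr -scalerAr linearP. Qed.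

HB.instance Definition _ := GRing.isLinear.Build K L _ _ mulmat mulmat_linear_is_linear.

Lemma mulmat1 : mulmat 1 = 1%:M.
Proof.
apply/matrixP => i j; rewrite !mxE mulr1 coord_free ?(basis_free (vbasisP _)) //.
Qed.

(** This is the field norm N of L over K. *)
Definition nrm y : K := \det (mulmat y).

Lemma nrm1 : nrm 1 = 1. Proof. by rewrite /nrm mulmat1 det1. Qed.

Lemma nrmM y z : nrm (y * z) = nrm y * nrm z.
Proof. by rewrite /nrm mulmatM det_mulmx. Qed.

Lemma nrmX y k : nrm (y ^+ k) = nrm y ^+ k.
Proof. by elim: k => [|k IH]; rewrite ?nrm1 // !exprS nrmM IH. Qed.

Lemma nrm_alg (c : K) : nrm c%:A = c ^+ n.
Proof. by rewrite /nrm linearZ /= mulmat1 scalemx1 det_scalar. Qed.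

Lemma nrm0 : nrm 0 = 0.
Proof. by rewrite -(scale0r 1) nrm_alg expr0n eqn0Ngt adim_gt0. Qed.

Lemma nrm_neq0 y : y != 0 -> nrm y != 0.
Proof.
move=> y0; apply/eqP => ny; have := nrmM y y^-1.
by rewrite divff // nrm1 ny mul0r => /eqP; rewrite oner_eq0.
Qed.

Lemma nrmV y : y != 0 -> nrm y^-1 = (nrm y)^-1.
Proof.
by move=> y0; apply: (mulfI (nrm_neq0 y0)); rewrite -nrmM !divff ?nrm1 ?nrm_neq0.
Qed.

Lemma polyfun_nrm (I : finType) (g : (I -> K) -> L) :
  polyfun g -> polyfun (A := K^o) (fun a => nrm (g a)).
Proof.
move=> pg; apply: polyfun_det => i j.
apply: eq_polyfun (_ : polyfun (A := K^o) (fun a => coord b j (b`_i * g a))) => [a|].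
  by rewrite mxE.
exact: (polyfun_linear (B := K^o) (coord b j) (polyfunM (polyfun_const b`_i) pg)).
Qed.

(** The minimal polynomial over the copy [1%AS] of K inside L, brought back to K[X]. *)
Lemma exists_irreducible_root y :
  exists2 f : {poly K}, f \is monic /\ irreducible_poly f &
    \sum_(i < size f) f`_i *: y ^+ i = 0.
Proof.
have /polyOver1P [f fE] := minPolyOver 1%AS y.
have mf : f \is monic by rewrite -(map_monic (in_alg L)) -fE monic_minPoly.
exists f; [split => // | ].
  split=> [|q q1 qf].
    by rewrite -(size_map_poly (in_alg L)) -fE (root_size_gt1 _ (root_minPoly _ _)) ?monic_neq0 ?monic_minPoly.
  have qL : map_poly (in_alg L) q %| minPoly 1%AS y by rewrite fE dvdp_map.
  have qO : map_poly (in_alg L) q \is a polyOver 1%VS by apply/polyOver1P; exists q.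
  have /orP[|] := minPoly_irr qO qL; first by rewrite fE eqp_map.
  by rewrite -size_poly_eq1 size_map_poly (negbTE q1).
have /rootP := root_minPoly 1%AS y; rewrite fE horner_coef size_map_poly.
by under eq_bigr do rewrite coef_map /= -scalerAl mul1r.
Qed.

(** With C the matrix of [y], X^i - C^i is a multiple of X - C over K[X]. Summing with the
    coefficients of [f] and using f(C) = 0, the scalar matrix f is a multiple of X - C; then take
    determinants. *)
Lemma char_poly_mulmat_dvd y (f : {poly K}) :
  \sum_(i < size f) f`_i *: y ^+ i = 0 -> char_poly (mulmat y) %| f ^+ n.
Proof.
move=> fy; pose C z : 'M[{poly K}]_n := map_mx polyC (mulmat z).
have CM z z' : C (z * z') = C z *m C z' by rewrite /C mulmatM map_mxM.
have H i : exists Q, ('X^i)%:M - C (y ^+ i) = char_poly_mx (mulmat y) *m Q.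
  elim: i => [|i [Q HQ]].
    by exists 0; rewrite expr0 /C mulmat1 map_mx1 subrr mulmx0.
  exists (('X^i)%:M + C y *m Q).
  rewrite mulmxDr mulmxA.
  have -> : char_poly_mx (mulmat y) *m C y = C y *m char_poly_mx (mulmat y).
    by rewrite /char_poly_mx mulmxBl mulmxBr scalar_mxC.
  rewrite -mulmxA -HQ /char_poly_mx -/(C y) mulmxBl mulmxBr -scalar_mxM -CM -!exprS.
  by rewrite addrA subrK.
have [Q HQ] := fin_all_exists (fun i : 'I_(size f) => H i).
apply/dvdpP; exists (\det (\sum_(i < size f) (f`_i)%:P *: Q i)).
rewrite mulrC -det_scalar -det_mulmx; congr (\det _).
rewrite mulmx_sumr; under eq_bigr => i _ do rewrite -scalemxAr -HQ scalerBr.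
rewrite sumrB [X in _ - X](_ : _ = C 0); last first.
  rewrite -fy /C linear_sum /= raddf_sum /=; apply: eq_bigr => i _.
  by rewrite linearZ /= map_mxZ.
rewrite /C linear0 map_mx0 subr0 {1}(poly_sum_coef (leqnn (size f))).
rewrite raddf_sum /=; apply: eq_bigr => i _.
by rewrite scale_scalar_mx mul_polyC.
Qed.

Variables (G D : oag) (v : valuation K G) (w : valuation L D).
Hypothesis ext_v : extremal v.
Hypothesis wE : forall c d : K, (c%:A <=[w] d%:A) = (c <=[v] d).

Lemma valring_alg (c : K) : (c%:A \in valring w) = (c \in valring v).
Proof. by rewrite !valringE -wE scale1r. Qed.

(** The characteristic polynomial is a power of an irreducible [f] with root [y], and its constant
    term is a sign. Hence f_0, and then all of [f], is integral, so [y] is integral over O. *)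
Lemma nrm_eq1_valring y : nrm y = 1 -> y \in valring w.
Proof.
move=> ny; have [f [mf irrf] fy] := exists_irreducible_root y.
have mchar := char_poly_monic (mulmat y).
have [k charE] := monic_dvd_irreducible_exp mf irrf mchar (char_poly_mulmat_dvd fy).
have k0 : (0 < k)%N.
  rewrite lt0n; apply: contra_eqN charE => /eqP->; rewrite expr0.
  apply/eqP => /(congr1 (fun p : {poly K} => size p)).
  by rewrite size_char_poly size_poly1 => -[] /eqP; rewrite eqn0Ngt adim_gt0.
have f0O : f`_0 \in valring v.
  have := char_poly_det (mulmat y); rewrite charE -/(nrm y) ny mulr1.
  rewrite -!horner_coef0 horner_exp => E.
  rewrite valringE -(vdvX2 _ _ _ k0) E expr1n -valringE rpredX // rpredN rpred1.
  by [].
have fO := extremal_irreducible_integral ext_v mf irrf f0O.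
have [s sf] : exists s, size f = s.+2.
  by case: irrf => + _; case: (size f) => [|[|s]] // _; exists s.
have fs : f`_s.+1 = 1 by have /monicP := mf; rewrite lead_coefE sf.
apply/negPn/negP => yO.
have y0 : y != 0 by apply: contraNneq yO => ->; rewrite rpred0.
have ylt : y <![w] 1 by [].
move: fy; rewrite sf big_ord_recr /= fs scale1r => /eqP; rewrite addr_eq0 => /eqP E.
(* As w(y) < 0, the leading term of f(y) = 0 has smaller value than all the others. *)
have : y ^+ s.+1 <![w] \sum_(i < s.+1) f`_i *: y ^+ i.
  apply: vdv_strict_sum; first exact: expf_neq0.
  case=> i /= ri _; rewrite -mulr_algl.
  apply: vdv_strict_transr (_ : y ^+ i <=[w] _); last first.
    by rewrite vdv_mull // valring_alg (polyOverP fO).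
  have -> : s.+1 = (i + (s - i).+1)%N by lia.
  rewrite exprD -{1}[y ^+ i]mulr1 vdvM2l ?expf_neq0 //.
  by rewrite -[X in X <=[w] _](expr1n _ (s - i).+1) vdvX2.
by rewrite E vdvNl vdv_refl.
Qed.

(** The norm of an element of K is its n-th power, so y^n / N(y) and its inverse have norm 1 and lie
    in O_w. This says n w(y) = v(N(y)). *)
Lemma vdv_nrm y : y ^+ n <=[w] (nrm y)%:A /\ (nrm y)%:A <=[w] y ^+ n.
Proof.
have [->|y0] := eqVneq y 0.
  by rewrite nrm0 scale0r expr0n eqn0Ngt adim_gt0 vdv_refl.
have ny0 := nrm_neq0 y0.
have nyA0 : (nrm y)%:A != 0 :> L by rewrite scaler_eq0 negb_or ny0 oner_neq0.
have yn0 : y ^+ n != 0 by apply: expf_neq0.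
have nyn : nrm (y ^+ n) = nrm (nrm y)%:A by rewrite nrmX nrm_alg.
split.
  have /nrm_eq1_valring : nrm ((nrm y)%:A / y ^+ n) = 1.
    by rewrite nrmM nrmV // nyn divff // nrm_neq0.
  by rewrite valringE vdv_divr // mul1r.
have /nrm_eq1_valring : nrm (y ^+ n / (nrm y)%:A) = 1.
  by rewrite nrmM nrmV // nyn divff // nrm_neq0.
by rewrite valringE vdv_divr // mul1r.
Qed.

Lemma vdv_nrmE y z : (nrm y <=[v] nrm z) = (y <=[w] z).
Proof.
have [y1 y2] := vdv_nrm y; have [z1 z2] := vdv_nrm z.
rewrite -wE -[in RHS](vdvX2 _ _ _ (adim_gt0 {:L}%AS)); apply/idP/idP => h.
  exact: vdv_trans (vdv_trans y1 h) z2.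
exact: vdv_trans (vdv_trans y2 h) z1.
Qed.

(** Maximising the value of [g] amounts to maximising that of its norm, a K-valued polynomial
    function. *)
Lemma extremal_nrm (I : finType) (g : (I -> K) -> L) :
  (0 < #|I|)%N -> polyfun g ->
  exists2 a : I -> K, (forall i, a i \in valring v) &
    forall a' : I -> K, (forall i, a' i \in valring v) -> g a' <=[w] g a.
Proof.
move=> I0 /polyfun_nrm /(extremal_polyfun ext_v I0) [a aO aP].
by exists a => // a' a'O; rewrite -vdv_nrmE; apply: aP.
Qed.

(** If w(y) < 0, then d = N(y) works, as its value n w(y) is at most w(y). *)
Lemma exists_base_below y : y != 0 ->
  exists2 d : K, d != 0 & d%:A <=[w] 1 /\ d%:A <=[w] y.
Proof.
move=> y0; have [y1|y1] := boolP (1 <=[w] y).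
  by exists 1; rewrite ?oner_neq0 // scale1r vdv_refl.
exists (nrm y); first exact: nrm_neq0.
have [_ ny] := vdv_nrm y.
have y1' : y <=[w] 1 by apply: vdv_strictW.
have yn m : y ^+ m <=[w] 1 by rewrite -(expr1n _ m) vdvX.
split; first exact: vdv_trans ny (yn n).
apply: vdv_trans ny _; rewrite -(prednK (adim_gt0 {:L}%AS)) exprS.
by rewrite -[X in _ <=[w] X]mulr1 vdvM2l.
Qed.

End Norm.

(** * Valuation bases *)

Definition vequiv (K : fieldType) (G : oag) (v : valuation K G) : rel K :=
  fun x y => (x <=[v] y) && (y <=[v] x).

Lemma vequivP (K : fieldType) (G : oag) (v : valuation K G) x y :
  reflect (v x = v y) (vequiv v x y).
Proof. by apply: (iffP andP) => [/vfun_eqE|/vfun_eqE]. Qed.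

(** The nonzero terms have pairwise distinct values, so the term of least value cannot be
    cancelled. *)
Lemma sum_inequivalent_vdv (K : fieldType) (G : oag) (v : valuation K G)
    (I : finType) (x : I -> K) :
  (forall i j, i != j -> x i != 0 -> ~~ vequiv v (x i) (x j)) ->
  forall i, \sum_j x j <=[v] x i.
Proof.
move=> xP i.
have [k _ kmin] := @exists_least K (vdv v) I xpredT x
  (@vdv_total _ _ v) (@vdv_trans _ _ v) (ex_intro _ i isT).
apply: vdv_trans (kmin i isT); have [xk0|xk0] := eqVneq (x k) 0; first by rewrite xk0 vdv0.
rewrite (bigD1 k) //=; set S := \sum_(j | _) _.
have kS : x k <![v] S.
  apply: vdv_strict_sum => // j jk; apply/negP => h.
  have := xP k j; rewrite eq_sym jk xk0 => /(_ isT isT); apply/negP/negPn.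
  by rewrite /vequiv h kmin.
apply/negPn/negP => h.
have : x k <![v] (x k + S) - S by apply: vdv_strictD; rewrite ?vdvNl.
by rewrite addrK vdv_refl.
Qed.

(** Proved classically, as [P] is an arbitrary proposition; it provides independent sequences of
    maximal length. *)
Lemma exists_maximum (P : nat -> Prop) m N :
  P m -> (forall n, P n -> (n <= N)%N) ->
  exists2 n, P n /\ (m <= n)%N & forall k, P k -> (k <= n)%N.
Proof.
move: {2}(N - m)%N (leqnn (N - m)) => d; elim: d m => [|d IH] m dm Pm PN.
  exists m; first by rewrite leqnn.
  by move=> k /PN kN; have := PN _ Pm; lia.
have [[k [Pk mk]]|h] := classic (exists k, P k /\ (m < k)%N).
  have [|n [Pn kn] nmax] := IH k _ Pk PN; first by have := PN _ Pk; lia.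
  by exists n => //; split=> //; lia.
exists m; first by rewrite leqnn.
by move=> k Pk; rewrite leqNgt; apply/negP => mk; apply: h; exists k.
Qed.

(** * Finite independent families and the dimension *)

Section IndependentFamily.
Variables (K : fieldType) (L : fieldExtType K) (I : finType) (b : I -> L).
Hypothesis bfree : forall c : I -> K, \sum_i c i *: b i = 0 -> forall i, c i = 0.

Let bt := [tuple b (enum_val i) | i < #|I|].

Let bt_sum (c : 'I_#|I| -> K) : \sum_i c i *: bt`_i = \sum_i c (enum_rank i) *: b i.
Proof.
rewrite [RHS](reindex _ (onW_bij _ (@enum_val_bij I))); apply: eq_bigr => i _.
by rewrite enum_valK -tnth_nth tnth_mktuple.
Qed.

Let bt_free : free bt.
Proof.
apply/freeP => c; rewrite bt_sum => /bfree c0 i.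
by have := c0 (enum_val i); rewrite enum_valK.
Qed.

Lemma card_indep : (#|I| <= \dim {:L})%N.
Proof. by rewrite -(size_tuple bt) -(eqnP bt_free) dimvS ?subvf. Qed.

Lemma card_indep_span : (forall y, exists c : I -> K, y = \sum_i c i *: b i) ->
  \dim {:L} = #|I|.
Proof.
move=> bspan; rewrite -(size_tuple bt) -(eqnP bt_free); congr (\dim _).
apply/eqP; rewrite eqEsubv subvf andbT; apply/subvP => y _.
have [c ->] := bspan y; apply: memv_suml => i _; apply/memvZ/memv_span.
by apply/tnthP; exists (enum_rank i); rewrite tnth_mktuple enum_rankK.
Qed.

End IndependentFamily.

(** * Coset representatives of the value group and lifts of a residue basis *)

Section ValuationBasis.
Variables (K : fieldType) (L : fieldExtType K).
Variables (G D : oag) (v : valuation K G) (w : valuation L D).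
Hypothesis wE : forall c d : K, (c%:A <=[w] d%:A) = (c <=[v] d).

(** The values of the s_i lie in distinct cosets of the value group of K. *)
Definition val_indep (s : seq L) :=
  all (fun y => y != 0) s /\
  forall i j, (i < size s)%N -> (j < size s)%N -> i <> j ->
    forall c : K, c != 0 -> ~~ vequiv w s`_i (c *: s`_j).

(** The residues of the t_i are linearly independent over the residue field of K. *)
Definition res_indep (t : seq L) :=
  all (mem (valring w)) t /\
  forall c : 'I_(size t) -> K, (forall i, c i \in valring v) ->
    1 <![w] \sum_i c i *: t`_i -> forall i, 1 <![v] c i.

Lemma vdvZ2r (c d : K) y : c <=[v] d -> c *: y <=[w] d *: y.
Proof. by move=> cd; rewrite -![_ *: y]mulr_algl vdvMr // wE. Qed.

Lemma vdvZ2l (c : K) y z : c != 0 -> (c *: y <=[w] c *: z) = (y <=[w] z).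
Proof. by move=> c0; rewrite -(mulr_algl c y) -(mulr_algl c z) vdvM2l // scaler_eq0 negb_or c0 oner_neq0. Qed.

(** After division by a nonzero coefficient of least value, the coefficients are integral and one of
    them is 1, so by independence of the residues the sum is a unit of O_w. *)
Lemma vequiv_res_sum (t : seq L) (c : 'I_(size t) -> K) : res_indep t ->
  exists2 d : K, vequiv w (\sum_i c i *: t`_i) d%:A & forall j, d <=[v] c j.
Proof.
move=> [/allP tO tP]; case: (posnP (size t)) => [t0|t0].
  have no_j : 'I_(size t) -> False by rewrite t0; case.
  exists 0; last by move=> j; case: (no_j j).
  by rewrite scale0r big1 /vequiv ?vdv_refl // => j; case: (no_j j).
have [k _ kmin] := @exists_least K (vdv v) 'I_(size t) xpredT c
  (@vdv_total _ _ v) (@vdv_trans _ _ v) (ex_intro _ (Ordinal t0) isT).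
exists (c k); last by move=> j; apply: kmin.
have [ck0|ck0] := eqVneq (c k) 0.
  rewrite ck0 scale0r big1 /vequiv ?vdv_refl // => i _.
  have /eqP-> : c i == 0 by rewrite -(vdv0l v) -ck0 kmin.
  by rewrite scale0r.
pose e i := (c k)^-1 * c i.
have -> : \sum_i c i *: t`_i = c k *: (\sum_i e i *: t`_i).
  by rewrite scaler_sumr; apply: eq_bigr => i _; rewrite scalerA mulVKf.
have eO i : e i \in valring v by rewrite /e valringE mulrC vdv_divr // mul1r kmin.
rewrite /vequiv !vdvZ2l //; apply/andP; split.
  apply/negPn/negP => h; have := tP e eO h k.
  by rewrite /e mulVf // vdv_refl.
apply: vdv_sum => i _; rewrite -valringE -mulr_algl rpredM //.
  by rewrite (valring_alg wE).
exact: tO (mem_nth _ (ltn_ord i)).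
Qed.

(** Grouped by [i], the sum is that of the s_i z_i, where z_i has the value of some d_i in K with
    v(d_i) at most every v(c_ij). The nonzero s_i z_i have values in distinct cosets, so nothing
    cancels. *)
Lemma basis_vdv (s t : seq L) (c : 'I_(size s) * 'I_(size t) -> K) i j :
  val_indep s -> res_indep t ->
  \sum_k c k *: (s`_k.1 * t`_k.2) <=[w] c (i, j) *: s`_i.
Proof.
move=> [/allP s0 sP] tP.
pose z i := \sum_j c (i, j) *: t`_j.
have -> : \sum_k c k *: (s`_k.1 * t`_k.2) = \sum_(i < size s) s`_i * z i.
  under [RHS]eq_bigr do rewrite mulr_sumr.
  by rewrite pair_big; apply: eq_bigr => -[i' j'] _; rewrite /= scalerAr.
have zP i' : exists d : K, vequiv w (z i') d%:A /\ forall j, d <=[v] c (i', j).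
  by have [d h1 h2] := vequiv_res_sum (fun j => c (i', j)) tP; exists d.
have [d dP] := fin_all_exists zP.
have sn0 i' : (i' < size s)%N -> s`_i' != 0 by move=> h; apply/s0/mem_nth.
have zd (i' : 'I_(size s)) : vequiv w (s`_i' * z i') (d i' *: s`_i').
  have [/andP [h1 h2] _] := dP i'.
  by rewrite -[d i' *: _]mulr_algr /vequiv !vdvM2l ?h1 ?h2 ?sn0.
apply: vdv_trans (_ : s`_i * z i <=[w] _).
  apply: sum_inequivalent_vdv => k l kl.
  rewrite mulf_eq0 negb_or => /andP[sk0 zk0]; apply/negP => /andP[h1 h2].
  have /andP[k1 k2] := zd k; have /andP[l1 l2] := zd l.
  have dk0 : d k != 0.
    apply: contraNneq zk0 => dk0; have [/andP[_]] := dP k.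
    by rewrite dk0 scale0r vdv0l.
  have dl0 : d l != 0.
    apply: contraNneq sk0 => dl0; move: l2; rewrite dl0 scale0r vdv0l => /eqP E.
    by move: h2; rewrite E vdv0l mulf_eq0 (negbTE zk0) orbF.
  have := sP k l (ltn_ord k) (ltn_ord l) _ ((d k)^-1 * d l).
  rewrite mulf_neq0 ?invr_eq0 // => /(_ _ isT)/negP; case.
    by move/eqP; rewrite (inj_eq val_inj); apply/negP.
  have vZ y y' : vequiv w (d k *: y) (d k *: y') = vequiv w y y'.
    by rewrite /vequiv !vdvZ2l.
  rewrite -vZ scalerA mulVKf //; apply/andP; split.
    exact: vdv_trans k2 (vdv_trans h1 l1).
  exact: vdv_trans l2 (vdv_trans h2 k1).
have [_ /(_ j)] := dP i => dc.
have /andP[h _] := zd i; exact: vdv_trans h (vdvZ2r _ dc).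
Qed.

Lemma basis_indep (s t : seq L) : val_indep s -> res_indep t ->
  forall c : 'I_(size s) * 'I_(size t) -> K,
    \sum_k c k *: (s`_k.1 * t`_k.2) = 0 -> forall k, c k = 0.
Proof.
move=> sP tP c c0 [i j]; have := basis_vdv c i j sP tP.
rewrite c0 vdv0l scaler_eq0 => /orP[/eqP//|].
by have [/allP h _] := sP; rewrite (negbTE (h _ (mem_nth _ _))).
Qed.

(** Pairing with a one-element sequence in [basis_indep] bounds the length of the other sequence by
    [L:K]. *)
Lemma val_indep1 : val_indep [:: 1].
Proof. by split; rewrite /= ?oner_neq0 // => -[|i] [|j]. Qed.

Lemma res_indep1 : res_indep [:: 1].
Proof.
split; first by rewrite /= andbT rpred1.
move=> c cO; rewrite big_ord1 /= => h i; rewrite (ord1 i).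
by rewrite -wE scale1r.
Qed.

(** In a sequence of maximal length every coset is represented, since an element with value in a new
    coset could be appended. *)
Lemma exists_val_basis : exists s, [/\ val_indep s, (0 < size s)%N &
  forall y, y != 0 -> exists i : 'I_(size s), exists2 c : K, c != 0 & vequiv w y (c *: s`_i)].
Proof.
pose P e := exists2 s, val_indep s & size s = e.
have [||e [[s sP se] e0] emax] := @exists_maximum P 1 (\dim {:L}).
- by exists [:: 1]; first exact: val_indep1.
- move=> e [s sP <-].
  by have := card_indep (basis_indep sP res_indep1); rewrite card_prod !card_ord muln1.
exists s; split=> [||y y0]; [exact: sP|by rewrite se|].
apply: NNPP => H.
have [sn0 sinj] := sP.
have Hy i c : (i < size s)%N -> c != 0 -> ~~ vequiv w y (c *: s`_i).
  by move=> si c0; apply/negP => h; apply: H; exists (Ordinal si); exists c.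
suff : P e.+1 by move/emax; rewrite ltnn.
exists (rcons s y); last by rewrite size_rcons se.
split; first by rewrite all_rcons y0.
move=> i j; rewrite size_rcons !ltnS !nth_rcons => si sj ij c c0.
case: (ltngtP i (size s)) si => // [si _|iE _]; case: (ltngtP j (size s)) sj => // [sj _|jE _].
- exact: sinj.
- have cV0 : c^-1 != 0 by rewrite invr_eq0.
  apply: contra (Hy i c^-1 si cV0).
  by rewrite /vequiv andbC -(vdvZ2l y _ c0) -(vdvZ2l _ y c0) !scalerA divff // !scale1r.
- exact: Hy.
- by case: ij; rewrite iE.
Qed.

Lemma exists_res_basis : exists t, [/\ res_indep t, (0 < size t)%N &
  forall y, y \in valring w -> exists c : 'I_(size t) -> K,
    (forall i, c i \in valring v) /\ 1 <![w] y - \sum_i c i *: t`_i].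
Proof.
pose P f := exists2 t, res_indep t & size t = f.
have [||f [[t tP tf] f0] fmax] := @exists_maximum P 1 (\dim {:L}).
- by exists [:: 1]; first exact: res_indep1.
- move=> f [t tP <-].
  by have := card_indep (basis_indep val_indep1 tP); rewrite card_prod !card_ord mul1n.
exists t; split=> [||y yO]; [exact: tP|by rewrite tf|].
apply: NNPP => H; have [tO tind] := tP.
suff : P f.+1 by move/fmax; rewrite ltnn.
exists (rcons t y); last by rewrite size_rcons tf.
split; first by rewrite all_rcons tO andbT.
rewrite size_rcons => c cO; rewrite big_ord_recr /= nth_rcons ltnn eqxx.
under eq_bigr => i _ do rewrite nth_rcons ltn_ord.
set u := c ord_max => h.
(* Were [u] a unit, [y] would be congruent modulo m to the combination of the t_i with coefficients
   -c_i / u. *)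
have um : 1 <![v] u.
  apply/negP => u1; apply: H.
  have u0 : u != 0 by apply: contraTneq u1 => ->; rewrite vdv0l oner_eq0.
  exists (fun i => - (u^-1 * c (widen_ord (leqnSn _) i))); split=> [i|].
    by rewrite rpredN mulrC valringE vdv_divr // mul1r; apply: vdv_trans u1 (cO _).
  rewrite -(vdvZ2l _ _ u0) scalerBr scaler_sumr -sumrN addrC.
  under eq_bigr => i _ do rewrite scalerA mulrN scaleNr opprK mulVKf //.
  by apply: contra h => /vdv_trans; apply; rewrite -[X in _ <=[w] X]scale1r wE.
have h' : 1 <![w] \sum_(i < size t) c (widen_ord (leqnSn _) i) *: t`_i.
  rewrite -[X in _ <![w] X](addrK (u *: y)) vdv_strictD // vdvNl.
  apply: (vdv_strict_transr (y := u%:A)).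
    by rewrite -[X in _ <=[w] X]scale1r wE.
  by rewrite -(mulr_algl u y) mulrC vdv_mull.
move=> i; case: (ltngtP i (size t)) => [it|ti|it].
- have := tind _ _ h' (Ordinal it); rewrite (_ : widen_ord _ _ = i) //; first by apply.
  exact: val_inj.
- by have := ltn_ord i; rewrite ltnS leqNgt ti.
- by rewrite (_ : i = ord_max) //; apply: val_inj.
Qed.

Hypothesis ext_v : extremal v.

(** Extremality gives a best approximation to [y] only among combinations with coefficients in d O.
    Here [d] has such low value that, by [basis_vdv], every combination u with w(y - u) >= w(y) has
    its coefficients in d O; so an improved approximation is still admissible. *)
Lemma basis_span (s t : seq L) : val_indep s -> res_indep t ->
  (0 < size s)%N -> (0 < size t)%N ->
  (forall y, y != 0 -> exists i : 'I_(size s), exists2 c : K, c != 0 & vequiv w y (c *: s`_i)) ->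
  (forall y, y \in valring w -> exists c : 'I_(size t) -> K,
    (forall i, c i \in valring v) /\ 1 <![w] y - \sum_i c i *: t`_i) ->
  forall y, exists c : 'I_(size s) * 'I_(size t) -> K,
    y = \sum_k c k *: (s`_k.1 * t`_k.2).
Proof.
move=> sP tP ps pt sspan tspan y; apply: NNPP => H.
have sn0 (i : 'I_(size s)) : s`_i != 0 by have [/allP h _] := sP; apply/h/mem_nth.
have y0 : y != 0.
  apply/eqP => y0; apply: H; exists (fun=> 0).
  by rewrite big1 // => k _; rewrite scale0r.
have low (i : 'I_(size s)) : exists d : K, d != 0 /\ (d <=[v] 1 /\ d *: s`_i <=[w] y).
  have [|d d0 [d1 dy]] := exists_base_below ext_v wE (y := y / s`_i).
    by rewrite mulf_neq0 ?invr_eq0.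
  exists d; split=> //; split; first by rewrite -wE scale1r.
  by move: dy; rewrite vdv_divr // mulr_algl.
(* All factors have value at most 0, so the product lies below each of them. *)
have [d_ dP] := fin_all_exists low; pose d := \prod_i d_ i.
have d0 : d != 0 by apply/prodf_neq0 => i _; have [] := dP i.
have dle (i : 'I_(size s)) : d *: s`_i <=[w] y.
  have [_ [_]] := dP i; apply: vdv_trans; apply: vdvZ2r.
  rewrite /d (bigD1 i) //= -[X in _ <=[v] X]mulr1; apply: vdvM; first exact: vdv_refl.
  apply: (big_ind (fun x => x <=[v] 1)) => [|x x' h h'|j _]; first exact: vdv_refl.
    by rewrite -[1]mulr1 vdvM.
  by have [_ []] := dP j.
pose g (x : 'I_(size s) * 'I_(size t) -> K) : L :=
  y - \sum_k (d * x k) *: (s`_k.1 * t`_k.2).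
have pg : polyfun g.
  apply: polyfunD; first exact: polyfun_const.
  apply: eq_polyfun (_ : polyfun (fun x : 'I_(size s) * 'I_(size t) -> K =>
    \sum_k x k *: (- d *: (s`_k.1 * t`_k.2)))) => [x|].
    rewrite -sumrN; apply: eq_bigr => k _.
    by rewrite scalerA mulrN scaleNr mulrC.
  by apply: polyfun_sum => k; apply: (polyfunZ (polyfun_var k) (polyfun_const _)).
have [|x xO xmax] := extremal_nrm ext_v wE _ pg.
  by rewrite card_prod !card_ord muln_gt0 ps.
set z := g x in xmax.
have z0 : z != 0.
  apply/eqP => /eqP; rewrite subr_eq0 => /eqP zE; apply: H.
  by exists (fun k => d * x k).
have yz : y <=[w] z.
  have := xmax (fun=> 0) (fun=> rpred0 _).
  by rewrite /g big1 ?subr0 // => k _; rewrite mulr0 scale0r.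
(* [z] has the value of e s_i; subtracting e s_i times a lift of the residue of z / (e s_i)
   increases the value. *)
have [i [e e0 /andP[ze ez]]] := sspan z z0.
have es0 : e *: s`_i != 0 by rewrite scaler_eq0 negb_or e0 sn0.
have [|c [cO cP]] := tspan (z / (e *: s`_i)).
  by rewrite valringE vdv_divr // mul1r.
pose c' (k : 'I_(size s) * 'I_(size t)) := d * x k + (if k.1 == i then e * c k.2 else 0).
set z' := y - \sum_k c' k *: (s`_k.1 * t`_k.2).
have zz' : z <![w] z'.
  have -> : z' = (z / (e *: s`_i) - \sum_j c j *: t`_j) * (e *: s`_i).
    rewrite mulrBl divfK // /z' /z /g -addrA -opprD; congr (_ - _).
    under eq_bigr do rewrite scalerDl.
    rewrite big_split /=; congr (_ + _).
    rewrite -(pair_bigA _ (fun i' j => (if i' == i then e * c j else 0) *: (s`_i' * t`_j))) /=.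
    rewrite (bigD1 i) //= [X in _ + X]big1 ?addr0 => [|k /negbTE ki]; last first.
      by rewrite big1 // => j _; rewrite ki scale0r.
    rewrite mulr_suml; apply: eq_bigr => j _; rewrite eqxx.
    by rewrite -scalerAl -scalerAr scalerA [t`_j * _]mulrC [e * _]mulrC.
  apply: vdv_strict_trans ze _.
  by rewrite -[X in X <![w] _]mul1r vdvM2r.
have cd (k : 'I_(size s) * 'I_(size t)) : d <=[v] c' k.
  have := basis_vdv c' k.1 k.2 sP tP; rewrite -surjective_pairing => h.
  rewrite -wE -(vdvM2r _ _ _ (sn0 k.1)) !mulr_algl.
  apply: vdv_trans (dle _) (vdv_trans _ h).
  have -> : \sum_k c' k *: (s`_k.1 * t`_k.2) = y - z' by rewrite /z' opprB addrCA subrr addr0.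
  apply: vdvB; first exact: vdv_refl.
  exact: vdv_trans yz (vdv_strictW zz').
have := xmax (fun k => c' k / d); rewrite {1}/g.
under eq_bigr do rewrite mulrC divfK //.
rewrite -/z' (negbTE zz') => /(_ _)/notF; apply=> k.
by rewrite valringE vdv_divr // mul1r.
Qed.

End ValuationBasis.

(** * Finite extensions *)

Section FiniteExtension.
Variables (K : fieldType) (L : fieldExtType K).
Variables (G D : oag) (v : valuation K G) (w : valuation L D).
Hypothesis ext_v : extremal v.
Hypothesis wE : forall c d : K, (c%:A <=[w] d%:A) = (c <=[v] d).

Lemma vdv_alg0 (c : K) y : y != 0 -> c%:A <=[w] y -> c != 0.
Proof. by move=> y0 cy; apply: contraNneq y0 => c0; rewrite -(vdv0l w) -(scale0r 1) -c0. Qed.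

(* Otherwise, after rescaling to 1 <= w(s), put n = [L:K] and a = N(s), so
   v(a) = n w(s), and maximise
   w(y + s a^-2 (y^n t - a)) over y, t in O: the pairs with y^n t = a take all values
   v(y) < w(s), and at any other pair some such value is not exceeded. *)
Lemma exists_best_base_below_inequiv s : 1 <=[w] s -> (forall c : K, ~~ vequiv w c%:A s) ->
  exists2 y : K, y%:A <=[w] s & forall y' : K, y'%:A <=[w] s -> y' <=[v] y.
Proof.
move=> s1 sN; apply: NNPP => H.
have {}H (y : K) : y%:A <=[w] s -> exists2 y' : K, y'%:A <=[w] s & y <![v] y'.
  move=> ys; apply: NNPP => H'; apply: H; exists y => // y' y's.
  by apply/negPn/negP => h; apply: H'; exists y'.
have s0 : s != 0 by apply: contraNneq (sN 0) => ->; rewrite scale0r /vequiv vdv_refl.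
set n := \dim {:L}; have n0 : (0 < n)%N by apply: adim_gt0.
pose a := nrm s; have a0 : a != 0 := nrm_neq0 s0.
have [sa as_] : s ^+ n <=[w] a%:A /\ a%:A <=[w] s ^+ n := vdv_nrm ext_v wE s.
have algX (c : K) m : (c ^+ m)%:A = c%:A ^+ m :> L by rewrite -in_algE rmorphXn.
pose q y t : K := (a ^+ 2)^-1 * (y ^+ n * t - a).
pose g (x : bool -> K) : L := (x true)%:A + q (x true) (x false) *: s.
have pg : polyfun g.
  have pA f : polyfun (A := K^o) f -> polyfun (fun x : bool -> K => f x *: (1 : L)).
    by move=> pf; apply: polyfunZ pf (polyfun_const _).
  apply: polyfunD; first exact/pA/polyfun_var.
  apply: polyfunZ; last exact: polyfun_const.
  apply: (polyfunM (A := K^o)); first exact: (polyfun_const (_ : K^o)).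
  apply: (polyfunD (A := K^o)); last exact: (polyfun_const (_ : K^o)).
  apply: (polyfunM (A := K^o)); last exact: polyfun_var.
  exact: (polyfunX (A := K^o) _ (polyfun_var _)).
have [|x xO xmax] := extremal_nrm ext_v wE _ pg; first by rewrite card_bool.
(* At t = a / y^n the correction term vanishes, and the function takes the value y. *)
have reach (y : K) : 1 <=[v] y -> y%:A <=[w] s -> y%:A <=[w] g x.
  move=> y1 ys; have y0 : y != 0 := vdv_alg0 s0 ys.
  have yn0 : y ^+ n != 0 by apply: expf_neq0.
  have := xmax (fun b => if b then y else a / y ^+ n).
  rewrite /g /q /= [y ^+ n * _]mulrC divfK // subrr mulr0 scale0r addr0; apply.
  case=> //; rewrite valringE vdv_divr // mul1r -wE algX.
  by apply: vdv_trans (vdvX _ ys) sa.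
have [y2 y2s y2_1] : exists2 y2 : K, y2%:A <=[w] s & 1 <![v] y2.
  by apply: H; rewrite scale1r.
have y2g := reach _ (vdv_strictW y2_1) y2s.
set y := x true; set t := x false; pose S := q y t *: s.
have yO : y \in valring v by apply: xO.
have gE : g x = y%:A + S by [].
(* If v(y) <= w(s), the maximum exceeds v(y), so y and S cancel and have equal value; as S is a
   K-multiple of s, this puts w(s) in the value group of K. *)
have [ys|ys] := boolP (y%:A <=[w] s).
  have [y3 y3s yy3] := H _ ys.
  have y3g := reach _ (vdv_trans yO (vdv_strictW yy3)) y3s.
  have yg : y%:A <![w] g x.
    by apply: vdv_strict_transr y3g; rewrite wE.
  have q0 : q y t != 0.
    by apply: contraNneq yg => q0; rewrite gE /S q0 scale0r addr0 vdv_refl.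
  have := sN ((q y t)^-1 * y); apply/negP/negPn.
  have vZ z z' : vequiv w (q y t *: z) (q y t *: z') = vequiv w z z'.
    by rewrite /vequiv !vdvZ2l.
  rewrite -vZ scalerA mulVKf // -/S; apply/andP; split.
    have -> : S = g x - y%:A by rewrite gE addrC addKr.
    by apply: vdvB; rewrite ?vdv_refl // vdv_strictW.
  apply/negPn/negP => yS; have : y%:A <![w] g x - S by apply: vdv_strictD; rewrite ?vdvNl.
  by rewrite gE addrK vdv_refl.
(* If v(y) > w(s), then y^n t - a has value at most v(a), so w(S) <= (1 - n) w(s) <= 0, whereas y
   and y + S have positive value. *)
have yny : y ^+ n <=[v] y ^+ n * t by rewrite mulrC vdv_mull // /t xO.
have ar : a <![v] y ^+ n * t.
  apply: vdv_strict_transr yny; rewrite -wE algX.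
  by apply: vdv_strict_trans as_ _; rewrite vdvX2.
have ra : y ^+ n * t - a <=[v] a.
  apply/negPn/negP => h.
  have : a <![v] y ^+ n * t - (y ^+ n * t - a) by apply: vdv_strictD; rewrite ?vdvNl.
  by rewrite opprB addrCA subrr addr0 vdv_refl.
have S1 : S <=[w] 1.
  apply: vdv_trans (_ : a^-1 *: s <=[w] _).
    apply: vdvZ2r => //; rewrite /q expr2 invfM -mulrA -[X in _ <=[v] X]mulr1.
    by rewrite vdvM2l ?invr_eq0 // mulrC vdv_divl // mul1r.
  rewrite -(vdvZ2l w _ _ a0) scalerA divff // scale1r; apply: vdv_trans sa.
  rewrite -(prednK n0) exprS -{1}[s]mulr1; apply: vdvM; first exact: vdv_refl.
  by rewrite -[1](expr1n _ n.-1) vdvX.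
have : 1 <![w] g x - y%:A.
  apply: vdv_strictD; last by rewrite vdvNl; apply: vdv_strict_trans ys.
  by apply: vdv_strict_transr y2g; rewrite -[X in X <![w] _]scale1r wE.
by rewrite gE addrC addKr S1.
Qed.

(** If w(s) is the value of some c in K, take c; otherwise divide [s] by an element of K of value at
    most w(s) to make its value nonnegative. *)
Lemma exists_best_base_below s : s != 0 ->
  exists2 y : K, y != 0 /\ y%:A <=[w] s & forall y' : K, y'%:A <=[w] s -> y' <=[v] y.
Proof.
move=> s0; suff [y ys yP] : exists2 y : K, y%:A <=[w] s & forall y' : K, y'%:A <=[w] s -> y' <=[v] y.
  by exists y => //; split=> //; apply: vdv_alg0 ys.
have [[c /andP[c1 c2]]|H] := classic (exists c : K, vequiv w c%:A s).
  by exists c => // y' y's; rewrite -wE; apply: vdv_trans c2.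
have [d d0 [_ ds]] := exists_base_below ext_v wE s0.
have dV0 : d^-1 != 0 by rewrite invr_eq0.
have shift (c : K) : (c%:A <=[w] d^-1 *: s) = ((d * c)%:A <=[w] s).
  by rewrite -(vdvZ2l w _ _ d0) !scalerA divff // scale1r.
have shift' (c : K) : (d^-1 *: s <=[w] c%:A) = (s <=[w] (d * c)%:A).
  by rewrite -(vdvZ2l w _ _ d0) !scalerA divff // scale1r.
have [||y ys yP] := @exists_best_base_below_inequiv (d^-1 *: s).
- by rewrite -[1]scale1r shift mulr1.
- move=> c; apply/negP => h; apply: H; exists (d * c).
  by move: h; rewrite /vequiv shift shift'.
exists (d * y); first by rewrite -shift.
move=> y' y's; rewrite -(divfK d0 y') mulrC vdvM2l //; apply: yP.
by rewrite shift mulrC divfK.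
Qed.

(** Choose d_i in K with w(d_i s_i) least among the nonnegative values of K-multiples of s_i. For y
    in O_w, [basis_vdv] gives w(c_ij s_i) >= 0, hence v(c_ij) >= v(d_i). *)
Lemma exists_integral_basis : exists (I : finType) (b : I -> L), (0 < #|I|)%N /\
  forall y, y \in valring w <-> exists2 x : I -> K,
    (forall i, x i \in valring v) & y = \sum_i x i *: b i.
Proof.
have [s [sP s0 sspan]] := exists_val_basis wE.
have [t [tP t0 tspan]] := exists_res_basis wE.
have span := basis_span wE ext_v sP tP s0 t0 sspan tspan.
have sn0 (i : 'I_(size s)) : s`_i != 0 by have [/allP h _] := sP; apply/h/mem_nth.
have dP (i : 'I_(size s)) : exists d : K, [/\ d != 0, 1 <=[w] d *: s`_i
    & forall c : K, 1 <=[w] c *: s`_i -> d <=[v] c].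
  have [y [y0 ys] yP] := exists_best_base_below (sn0 i).
  have yZ z z' : (y *: z <=[w] y *: z') = (z <=[w] z') by apply: vdvZ2l.
  exists y^-1; split; first by rewrite invr_eq0.
    by rewrite -yZ scalerA divff // scale1r.
  move=> c cs; have [->|c0] := eqVneq c 0; first exact: vdv0.
  have /yP : (c^-1)%:A <=[w] s`_i by rewrite -(vdvZ2l w _ _ c0) scalerA divff // scale1r.
  by move=> h; rewrite -[y^-1]mul1r vdv_divl // -(mulfV c0) vdvM2l.
have [d {}dP] := fin_all_exists dP.
exists ('I_(size s) * 'I_(size t))%type, (fun k : 'I_(size s) * 'I_(size t) => d k.1 *: (s`_k.1 * t`_k.2)).
split; first by rewrite card_prod !card_ord muln_gt0 s0.
move=> y; split=> [yO|[x xO ->]].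
  have [c yE] := span y.
  exists (fun k => c k / d k.1); last first.
    by rewrite {1}yE; apply: eq_bigr => k _; rewrite scalerA divfK //; have [] := dP k.1.
  move=> k; have [d0 _ dmin] := dP k.1.
  rewrite valringE vdv_divr // mul1r; apply: dmin; apply: vdv_trans yO _.
  by rewrite yE [k in c k]surjective_pairing; apply: basis_vdv.
apply: rpred_sum => k _; rewrite -mulr_algl rpredM ?(valring_alg wE) //.
have [_ h _] := dP k.1; rewrite scalerAl rpredM //.
by have [/allP tO _] := tP; apply/tO/mem_nth.
Qed.

(** Each variable over O_w is expanded in the integral basis, turning [F] into an L-valued
    polynomial function on a power of O. *)
Lemma extremal_extension : extremal w.
Proof.
move=> m m0 F; have [I [b [I0 bP]]] := exists_integral_basis.
pose ev (x : 'I_m * I -> K) (k : 'I_m) : L := \sum_i x (k, i) *: b i.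
have pg : polyfun (fun x => meval F (ev x)).
  apply: polyfun_sum => mon; apply: polyfunM; first exact: polyfun_const.
  apply: polyfun_prod => k; apply: polyfunX; apply: polyfun_sum => i.
  exact: polyfunZ (polyfun_var _) (polyfun_const _).
have [|x xO xmax] := extremal_nrm ext_v wE _ pg.
  by rewrite card_prod card_ord muln_gt0 m0.
exists (ev x); split=> [k|y yO].
  by rewrite in_O_valring; apply/bP; exists (fun i => x (k, i)).
have yE k : exists z : I -> K, (forall i, z i \in valring v) /\ y k = \sum_i z i *: b i.
  by have := yO k; rewrite in_O_valring => /bP[z zO zE]; exists z.
have [z zP] := fin_all_exists yE.
have -> : meval F y = meval F (ev (fun p => z p.1 p.2)).
  apply: eq_bigr => mon _; congr (_ * _); apply: eq_bigr => k _.
  by rewrite {1}(proj2 (zP k)).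
by apply: xmax => k; apply: (proj1 (zP k.1)).
Qed.

(** The products s_i t_j are independent and span L, so their number is [L:K]. *)
Lemma fundamental_equality : exists e f : nat,
  [/\ ram_index w e, res_deg v w f & \dim (fullv : {vspace L}) = (e * f)%N].
Proof.
have [s [sP s0 sspan]] := exists_val_basis wE.
have [t [tP t0 tspan]] := exists_res_basis wE.
have span := basis_span wE ext_v sP tP s0 t0 sspan tspan.
exists (size s), (size t); split.
- have [sn0 sinj] := sP; exists s; split=> //.
    move=> i j si sj ij x x0; rewrite -vfunM mulr_algr => /vequivP.
    exact/negP/sinj.
  move=> y y0; have [i [c c0 yc]] := sspan y y0.
  exists i, c; split=> //; rewrite -vfunM mulr_algr; exact/vequivP.
- have [tO tind] := tP; exists t; split=> //.
  + by apply: sub_all tO => y; rewrite in_O_valring.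
  + move=> c cO; rewrite in_mE => cm i; rewrite in_mE; apply: tind cm i => i.
    by rewrite -in_O_valring.
  move=> y; rewrite in_O_valring => /tspan[c [cO yc]]; exists c.
  by rewrite in_mE; split=> // i; rewrite in_O_valring.
by rewrite (card_indep_span (basis_indep wE sP tP) span) card_prod !card_ord.
Qed.

End FiniteExtension.

Theorem theorem3p11 (K : fieldType) (G : oag) (v : valuation K G) :
  extremal v ->
  alg_complete v /\
  (forall (L : fieldExtType K) (D : oag) (w : valuation L D),
      extends v w -> extremal w).
Proof.
move=> ext_v.
have vdv_extends (L : fieldExtType K) (D : oag) (w : valuation L D) :
    extends v w -> forall c d : K, (c%:A <=[w] d%:A) = (c <=[v] d).
  move=> [iota [_ iota_le wE]] c d; rewrite /vdv !wE.
  by case: (v c) (v d) => [x|] [y|] //=; rewrite iota_le.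
split; first split; first exact: extremal_henselian.
  by move=> L D w /vdv_extends; apply: fundamental_equality.
by move=> L D w /vdv_extends; apply: extremal_extension.
Qed.
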